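(* For all integers $n\ge 1$ and $k\ge 4n$, there exist a complex affine algebraic manifold $Z_{n,k}$ of complex dimension $N=2k+2(k^2+n(k-n))$ possessing a real structure (i.e. an anti-holomorphic algebraic involution) and an algebraic distribution $\mathcal{D}_{n,k}\subset TZ_{n,k}$ of codimension $n$ (an algebraic subbundle of the tangent bundle of corank $n$), such that every compact $n$-dimensional almost complex manifold $(X,J)$ admits an embedding $f:X\hookrightarrow Z^{\mathbb{R}}_{n,k}$ that is transverse to $\mathcal{D}_{n,k}$ and contained in the real part $Z^{\mathbb{R}}_{n,k}$ of $Z_{n,k}$, with $J=J_f$.
   Context: An almost complex manifold of dimension $n$ is a pair $(X,J)$, where $X$ is a real $\mathcal{C}^\infty$ manifold of real dimension $2n$ and $J$ is a $\mathcal{C}^\infty$ section of $\mathrm{End}(TX)$ with $J^2=-\mathrm{Id}$. The real part $Z^{\mathbb{R}}$ of a complex manifold with a real structure is the fixed point set of the anti-holomorphic involution. Let $Z$ be a complex manifold and $\mathcal{D}\subset TZ$ a holomorphic subbundle of corank $n$ (a distribution of codimension $n$, not assumed integrable). A smooth embedding $f:X\hookrightarrow Z$ of a real $2n$-dimensional manifold $X$ is transverse to $\mathcal{D}$ if $f_*T_xX\oplus\mathcal{D}_{f(x)}=T_{f(x)}Z$ (as real vector spaces) for every $x\in X$. Then $f_*$ induces an $\mathbb{R}$-linear isomorphism $TX\simeq f^*(TZ/\mathcal{D})$, and $J_f$ denotes the almost complex structure on $X$ obtained by transporting to $TX$ through this isomorphism the complex structure of the complex vector bundle $TZ/\mathcal{D}$.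 *)

(* Defs.v *)
From HB Require Import structures.
From mathcomp Require Import all_boot all_order all_algebra complex.
(* Only the structures of multinomials are imported: its notations clash with
   those of the analysis library. *)
From mathcomp Require Import (canonicals, coercions) mpoly.
From mathcomp Require Import all_classical all_reals all_analysis.

Set Implicit Arguments.
Unset Strict Implicit.
Unset Printing Implicit Defensive.

Import Order.TTheory GRing.Theory Num.Theory.
Import numFieldNormedType.Exports.

Local Open Scope classical_set_scope.
Local Open Scope ring_scope.

Fixpoint Ck_on (R : realType) (V W : normedModType R) (k : nat) (A : set V)
    (f : V -> W) : Prop :=
  match k with
  | 0 => forall x, A x -> {for x, continuous f}
  | k'.+1 => (forall x, A x -> differentiable f x) /\
             (forall v, Ck_on k' A (fun x => 'd f x v))
  end.

(* Meaningful for A open; the values of f outside of A are irrelevant. *)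
Definition smooth_on (R : realType) (V W : normedModType R) (A : set V)
  (f : V -> W) : Prop := forall k, Ck_on k A f.

(* A smooth structure is given by an atlas, not required to be maximal;
   [chart_inv i] only matters on the open set [chart i @` dom i]. *)
Record smooth_manifold (R : realType) (d : nat) := SmoothManifold {
  carrier :> topologicalType;
  chart_index : Type;
  dom : chart_index -> set carrier;
  chart : chart_index -> carrier -> 'rV[R]_d;
  chart_inv : chart_index -> 'rV[R]_d -> carrier;
  manifold_hausdorff : hausdorff_space carrier;
  manifold_second_countable : @second_countable carrier;
  dom_cover : forall x, exists i, dom i x;
  dom_open : forall i, open (dom i);
  chart_open : forall i, open (chart i @` dom i);
  chartK : forall i x, dom i x -> chart_inv i (chart i x) = x;
  chart_continuous : forall i, {within dom i, continuous (chart i)};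
  chart_inv_continuous :
    forall i, {within chart i @` dom i, continuous (chart_inv i)};
  transition_smooth : forall i j,
    smooth_on (chart i @` (dom i `&` dom j)) (chart j \o chart_inv i)
}.

Arguments chart_index {R d} s.
Arguments dom {R d} s i.
Arguments chart {R d} s i x.
Arguments chart_inv {R d} s i y.

(* The section J of End(TX) is given by its matrices [acm_J i x] in the charts
   (tangent vectors at x being row vectors v in the chart i, so that Jv is
   [v *m acm_J i x]), subject to the transformation law of End(TX). *)
Record almost_complex_manifold (R : realType) (n : nat) :=
  AlmostComplexManifold {
  acm_manifold :> smooth_manifold R (2 * n);
  acm_J : chart_index acm_manifold -> acm_manifold -> 'M[R]_(2 * n);
  acm_J_smooth : forall i,
    smooth_on (chart acm_manifold i @` dom acm_manifold i)
              (acm_J i \o chart_inv acm_manifold i);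
  acm_J_transition : forall i j x (v : 'rV[R]_(2 * n)),
    dom acm_manifold i x -> dom acm_manifold j x ->
    let dtau := 'd (chart acm_manifold j \o chart_inv acm_manifold i)
                   (chart acm_manifold i x) in
    dtau (v *m acm_J i x) = dtau v *m acm_J j x;
  acm_J_sqr : forall i x, dom acm_manifold i x ->
    acm_J i x *m acm_J i x = - 1%:M
}.

Definition evalp (R : realType) (m : nat) (p : mpoly.mpoly m R[i])
  (z : 'rV[R[i]]_m) : R[i] := mpoly.meval (fun i => z 0 i) p.

Definition gradp (R : realType) (m : nat) (p : mpoly.mpoly m R[i])
  (z : 'rV[R[i]]_m) : 'rV[R[i]]_m := \row_i evalp (mpoly.mderiv i p) z.

Definition algebraic_set (R : realType) (m : nat) (Z : set 'rV[R[i]]_m) : Prop :=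
  exists (r : nat) (F : 'I_r -> mpoly.mpoly m R[i]),
    Z = [set z | forall j, evalp (F j) z = 0].

(* A closed algebraic subset of C^m which, near each of its points (on a
   Zariski open neighbourhood {h <> 0}), is the zero locus of m - N polynomials
   whose differentials are linearly independent at the point. *)
Definition affine_algebraic_manifold (R : realType) (m N : nat)
    (Z : set 'rV[R[i]]_m) : Prop :=
  [/\ (N <= m)%N, algebraic_set Z &
    forall z0, Z z0 ->
      exists (h : mpoly.mpoly m R[i]) (G : 'I_(m - N) -> mpoly.mpoly m R[i]),
      [/\ evalp h z0 != 0,
          forall z, evalp h z != 0 -> (Z z <-> forall j, evalp (G j) z = 0) &
          row_free (\matrix_(j < m - N) gradp (G j) z0)]].

(* The holomorphic tangent space, as a subspace of C^m. *)
Definition tangent_space (R : realType) (m : nat) (Z : set 'rV[R[i]]_m)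
    (z : 'rV[R[i]]_m) : set 'rV[R[i]]_m :=
  [set w | forall p : mpoly.mpoly m R[i], (forall y, Z y -> evalp p y = 0) ->
             \sum_i gradp p z 0 i * w 0 i = 0].

(* An anti-holomorphic algebraic involution of Z: the conjugate of a regular
   map, that is, of the restriction to Z of a polynomial map of C^m. *)
Definition real_structure (R : realType) (m : nat) (Z : set 'rV[R[i]]_m)
    (sigma : 'rV[R[i]]_m -> 'rV[R[i]]_m) : Prop :=
  [/\ exists P : 'I_m -> mpoly.mpoly m R[i],
        forall z, Z z -> sigma z = \row_j (evalp (P j) z)^*,
      forall z, Z z -> Z (sigma z) &
      forall z, Z z -> sigma (sigma z) = z].

Definition real_part (R : realType) (m : nat) (Z : set 'rV[R[i]]_m)
    (sigma : 'rV[R[i]]_m -> 'rV[R[i]]_m) : set 'rV[R[i]]_m :=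
  [set z | Z z /\ sigma z = z].

(* An algebraic subbundle of rank N - n of TZ: each fibre lies in the tangent
   space, and Zariski locally the fibres have a basis depending algebraically
   on the point. The frames can be taken polynomial, since on {h <> 0} the
   denominators of a regular frame are units. *)
Definition algebraic_distribution (R : realType) (m N n : nat)
    (Z : set 'rV[R[i]]_m) (D : 'rV[R[i]]_m -> {vspace 'rV[R[i]]_m}) : Prop :=
  [/\ (n <= N)%N,
      forall z w, Z z -> w \in D z -> tangent_space Z z w &
      forall z0, Z z0 ->
        exists (h : mpoly.mpoly m R[i])
               (e : 'I_(N - n) -> 'I_m -> mpoly.mpoly m R[i]),
          evalp h z0 != 0 /\
          forall z, Z z -> evalp h z != 0 ->
            basis_of (D z)
              [tuple (\row_i evalp (e j i) z : 'rV[R[i]]_m) | j < N - n]].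

Definition realify (R : realType) (m : nat) (z : 'rV[R[i]]_m) : 'rV[R]_(m + m) :=
  row_mx (map_mx (@complex.Re R) z) (map_mx (@complex.Im R) z).

Definition complexify (R : realType) (m : nat) (w : 'rV[R]_(m + m)) :
  'rV[R[i]]_m := \row_j (lsubmx w 0 j +i* rsubmx w 0 j)%C.

(* The differential of f at x, read in the chart i. *)
Definition pushforward (R : realType) (d m : nat) (X : smooth_manifold R d)
    (f : X -> 'rV[R[i]]_m) (i : chart_index X) (x : X) (v : 'rV[R]_d) :
  'rV[R[i]]_m :=
  complexify ('d (@realify R m \o f \o chart_inv X i) (chart X i x) v).

(* A smooth immersion which is a homeomorphism onto its image. As Z is an
   embedded submanifold of C^m, f is an embedding into Z if and only if it is
   an embedding into C^m with values in Z. *)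
Definition smooth_embedding (R : realType) (d m : nat) (X : smooth_manifold R d)
    (f : X -> 'rV[R[i]]_m) : Prop :=
  [/\ forall i, smooth_on (chart X i @` dom X i)
                          (@realify R m \o f \o chart_inv X i),
      forall i x, dom X i x -> injective (pushforward f i x),
      injective f &
      forall U : set X, open U ->
        exists2 V : set 'rV[R]_(m + m), open V &
          U = (@realify R m \o f) @^-1` V].

Definition transverse (R : realType) (d m : nat) (X : smooth_manifold R d)
    (Z : set 'rV[R[i]]_m) (D : 'rV[R[i]]_m -> {vspace 'rV[R[i]]_m})
    (f : X -> 'rV[R[i]]_m) : Prop :=
  forall i x, dom X i x ->
    (forall w, tangent_space Z (f x) w <->
       exists (v : 'rV[R]_d) (u : 'rV[R[i]]_m),
         u \in D (f x) /\ w = pushforward f i x v + u) /\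
    (forall v, pushforward f i x v \in D (f x) -> pushforward f i x v = 0).

(* J = J_f: in T_{f(x)}Z / D_{f(x)}, the class of f_*(Jv) is i times the class
   of f_*v. When f is an immersion transverse to D, this determines J. *)
Definition induces_J (R : realType) (n m : nat)
    (X : almost_complex_manifold R n)
    (D : 'rV[R[i]]_m -> {vspace 'rV[R[i]]_m}) (f : X -> 'rV[R[i]]_m) : Prop :=
  forall i x (v : 'rV[R]_(2 * n)), dom X i x ->
    pushforward f i x (v *m acm_J i x) - 'i *: pushforward f i x v \in D (f x).

(* Main.v *)
(* Let a = 4n + 1. The variety consists of the triples (x, j, y) with x in C^a,
   j an a x a matrix such that j^3 + j = 0, tr j = 0 and tr j^2 = - 2n (its
   eigenvalues i, - i, 0 have multiplicities n, n, a - 2n), and y in an affine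
   space which adjusts the dimension; the real structure is complex conjugation.
   If P is the spectral projector of j for the eigenvalue i, a polynomial in j,
   the distribution is { x' P = 0 } in the tangent space.

   A compact X embeds in R^a by Whitney's theorem; let A(x) be the derivative of
   this embedding phi. The matrix j(x) equal to J on the image of A(x) and to 0
   on its orthogonal complement is real and satisfies the equations, and
   f = (phi, j, 0) works since v |-> v A(x) P is C-linear from (T_x X, J) onto
   the image of P.

   Since j commutes with j^3 + j, the equations are redundant: near a point j0
   those which are diagonal for the spectral decomposition of j0 suffice.

   For Whitney's theorem, bump functions embed X in some R^M. A vector outside
   the secants and the tangents of the image is the direction of a projection
   to R^(M-1) which preserves the embedding; it exists by Baire's theorem, a
   differentiable map from R^p to R^q with p < q having a meager image. *)
Require Import Defs.
From HB Require Import structures.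
From mathcomp Require Import all_boot all_order all_algebra complex.
From mathcomp Require Import (canonicals, coercions) mpoly.
From mathcomp Require Import all_classical all_reals all_analysis.
From mathcomp Require Import ring lra zify.

Set Implicit Arguments.
Unset Strict Implicit.
Unset Printing Implicit Defensive.

Import Order.TTheory GRing.Theory Num.Theory.
Import numFieldNormedType.Exports.

Local Open Scope classical_set_scope.
Local Open Scope ring_scope.

(** * Polynomial functions and their directional derivatives *)

(** The point [f(x)] itself must carry [J], because the distribution is fixed in advance. As [f]
    takes real values, the complexified tangent space of [X] sits in that of [Z] and splits into the
    eigenspaces of [J] for [i] and [- i]. A real vector is determined by its [i] component, on which
    [J] is multiplication by [i]. So a complex distribution that contains the [- i] components and
    meets the [i] components trivially induces [J]; the kernel of [x' P] does so and depends on [j]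
    only. Its codimension is the rank [n] of [P].

    Extending [J] by zero on the orthogonal complement makes [j(x)] independent of the chart and
    keeps all values in one conjugacy class, of dimension [a^2 - (2 n^2 + (a - 2n)^2)]. Tangent
    spaces are defined by all polynomials vanishing on [Z], but no ideal is computed: the equations
    bound the tangent space from above, and lines contained in [Z] bound it from below.

    With [a = 4n + 1], the pairs [(x, j)] take [10 n^2 + 8 n + 1] dimensions, while
    [N >= 38 n^2 + 8 n] as soon as [k >= 4n]; [y] fills the gap. Vectors are rows, so matrices act
    on the right. *)

Definition polyfun (R : realType) (m : nat) (g : 'rV[R[i]]_m -> R[i]) :=
  exists p : mpoly.mpoly m R[i], forall z, evalp p z = g z.

Definition polymx (R : realType) (m p q : nat)
    (g : 'rV[R[i]]_m -> 'M[R[i]]_(p, q)) :=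
  forall i j, polyfun (fun z => g z i j).

Section Polyfun.
Variables (R : realType) (m : nat).
Implicit Types (g h : 'rV[R[i]]_m -> R[i]).

Lemma polyfun_ext g h : g =1 h -> polyfun g -> polyfun h.
Proof. by move=> e [p hp]; exists p => z; rewrite hp e. Qed.

Lemma polyfun_cst c : polyfun (fun _ : 'rV[R[i]]_m => c).
Proof. by exists (mpoly.mpolyC m c) => z; rewrite /evalp mpoly.mevalC. Qed.

Lemma polyfun_coord i : polyfun (fun z : 'rV[R[i]]_m => z 0 i).
Proof.
by exists (mpoly.mpolyX R[i] (mpoly.mnm1 i)) => z; rewrite /evalp mpoly.mevalXU.
Qed.

Lemma polyfunD g h : polyfun g -> polyfun h -> polyfun (fun z => g z + h z).
Proof.
move=> [p hp] [q hq]; exists (p + q) => z.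
by rewrite /evalp mpoly.mevalD -hp -hq.
Qed.

Lemma polyfunM g h : polyfun g -> polyfun h -> polyfun (fun z => g z * h z).
Proof.
move=> [p hp] [q hq]; exists (p * q) => z.
by rewrite /evalp mpoly.mevalM -hp -hq.
Qed.

Lemma polyfunN g : polyfun g -> polyfun (fun z => - g z).
Proof.
by move=> [p hp]; exists (- p) => z; rewrite /evalp mpoly.mevalN -hp.
Qed.

Lemma polyfun_sum I (r : seq I) P (g : I -> 'rV[R[i]]_m -> R[i]) :
  (forall k, polyfun (g k)) -> polyfun (fun z => \sum_(k <- r | P k) g k z).
Proof.
move=> hg; elim: r => [|k r IH].
  by apply: polyfun_ext (polyfun_cst 0) => z; rewrite big_nil.
case Pk: (P k); last by apply: polyfun_ext IH => z; rewrite big_cons Pk.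
by apply: polyfun_ext (polyfunD (hg k) IH) => z; rewrite big_cons Pk.
Qed.

Lemma polyfun_prod I (r : seq I) P (g : I -> 'rV[R[i]]_m -> R[i]) :
  (forall k, polyfun (g k)) -> polyfun (fun z => \prod_(k <- r | P k) g k z).
Proof.
move=> hg; elim: r => [|k r IH].
  by apply: polyfun_ext (polyfun_cst 1) => z; rewrite big_nil.
case Pk: (P k); last by apply: polyfun_ext IH => z; rewrite big_cons Pk.
by apply: polyfun_ext (polyfunM (hg k) IH) => z; rewrite big_cons Pk.
Qed.

Lemma polymx_cst p q (c : 'M[R[i]]_(p, q)) : polymx (fun _ : 'rV[R[i]]_m => c).
Proof. by move=> i j; exact: polyfun_cst. Qed.

Lemma polymxD p q (g h : 'rV[R[i]]_m -> 'M[R[i]]_(p, q)) :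
  polymx g -> polymx h -> polymx (fun z => g z + h z).
Proof.
move=> hg hh i j; apply: polyfun_ext (polyfunD (hg i j) (hh i j)) => z.
by rewrite mxE.
Qed.

Lemma polymxN p q (g : 'rV[R[i]]_m -> 'M[R[i]]_(p, q)) :
  polymx g -> polymx (fun z => - g z).
Proof.
by move=> hg i j; apply: polyfun_ext (polyfunN (hg i j)) => z; rewrite mxE.
Qed.

Lemma polymxM p q r (g : 'rV[R[i]]_m -> 'M[R[i]]_(p, q))
    (h : 'rV[R[i]]_m -> 'M[R[i]]_(q, r)) :
  polymx g -> polymx h -> polymx (fun z => g z *m h z).
Proof.
move=> hg hh i j.
apply: (@polyfun_ext (fun z => \sum_k g z i k * h z k j)) => [z|].
  by rewrite mxE.
by apply: polyfun_sum => k; apply: polyfunM.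
Qed.

Lemma polymxZ p q c (g : 'rV[R[i]]_m -> 'M[R[i]]_(p, q)) :
  polymx g -> polymx (fun z => c *: g z).
Proof.
move=> hg i j; apply: polyfun_ext (polyfunM (polyfun_cst c) (hg i j)) => z.
by rewrite mxE.
Qed.

Lemma polyfun_det p (g : 'rV[R[i]]_m -> 'M[R[i]]_p) :
  polymx g -> polyfun (fun z => \det (g z)).
Proof.
move=> hg; apply: polyfun_sum => s; apply: polyfunM; first exact: polyfun_cst.
by apply: polyfun_prod => k; exact: hg.
Qed.

Lemma polyfun_trace p (g : 'rV[R[i]]_m -> 'M[R[i]]_p) :
  polymx g -> polyfun (fun z => \tr (g z)).
Proof. by move=> hg; apply: polyfun_sum => k; exact: hg. Qed.

Lemma polymx_row_mx p q1 q2 (g : 'rV[R[i]]_m -> 'M[R[i]]_(p, q1))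
    (h : 'rV[R[i]]_m -> 'M[R[i]]_(p, q2)) :
  polymx g -> polymx h -> polymx (fun z => row_mx (g z) (h z)).
Proof.
move=> hg hh i j; case: (split_ordP j) => k ->.
  by apply: polyfun_ext (hg i k) => z; rewrite row_mxEl.
by apply: polyfun_ext (hh i k) => z; rewrite row_mxEr.
Qed.

Lemma polymx_col_mx p1 p2 q (g : 'rV[R[i]]_m -> 'M[R[i]]_(p1, q))
    (h : 'rV[R[i]]_m -> 'M[R[i]]_(p2, q)) :
  polymx g -> polymx h -> polymx (fun z => col_mx (g z) (h z)).
Proof.
move=> hg hh i j; case: (split_ordP i) => k ->.
  by apply: polyfun_ext (hg k j) => z; rewrite col_mxEu.
by apply: polyfun_ext (hh k j) => z; rewrite col_mxEd.
Qed.

Lemma polymx_block p1 p2 q1 q2 (a : 'rV[R[i]]_m -> 'M[R[i]]_(p1, q1))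
    (b : 'rV[R[i]]_m -> 'M[R[i]]_(p1, q2))
    (c : 'rV[R[i]]_m -> 'M[R[i]]_(p2, q1))
    (d : 'rV[R[i]]_m -> 'M[R[i]]_(p2, q2)) :
  polymx a -> polymx b -> polymx c -> polymx d ->
  polymx (fun z => block_mx (a z) (b z) (c z) (d z)).
Proof.
by move=> *; apply: polymx_col_mx; apply: polymx_row_mx.
Qed.

Lemma polymx_mxvec p q (g : 'rV[R[i]]_m -> 'M[R[i]]_(p, q)) :
  polymx g -> polymx (fun z => mxvec (g z)).
Proof.
move=> hg i j; rewrite (ord1 i); case/mxvec_indexP: j => k l.
by apply: polyfun_ext (hg k l) => z; rewrite mxvecE.
Qed.

Lemma polymx_lin p q r s (f : 'rV[R[i]]_m -> 'M[R[i]]_(p, q) -> 'M[R[i]]_(r, s)) :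
  (forall W, polymx (fun z => f z W)) -> polymx (fun z => lin_mx (f z)).
Proof.
move=> hf i j.
apply: polyfun_ext (polymx_mxvec (hf (vec_mx (delta_mx 0 i))) 0 j) => z.
by rewrite !mxE /=.
Qed.

End Polyfun.

(** In characteristic zero the integers below the size of [p - q] are distinct, and a nonzero
    polynomial has fewer roots than its size. *)
Lemma poly_eqfun (F : numFieldType) (p q : {poly F}) :
  (forall t, p.[t] = q.[t]) -> p = q.
Proof.
move=> e; apply/eqP; rewrite -subr_eq0; apply/negPn/negP => nz.
have /= := max_poly_roots (rs := [seq k%:R | k <- iota 0 (size (p - q))]) nz.
rewrite size_map size_iota ltnn => H; apply: notF; apply: H.
  by apply/allP => _ /mapP[k _ ->]; rewrite /root !hornerE e subrr.
by rewrite map_inj_uniq ?iota_uniq // => x y /eqP; rewrite eqr_nat => /eqP.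
Qed.

Section DirectionalDerivative.
Variables (R : realType) (m : nat).

Definition dpol (p : mpoly.mpoly m R[i]) (z w : 'rV[R[i]]_m) : R[i] :=
  \sum_k gradp p z 0 k * w 0 k.

Lemma dpolD p z w1 w2 : dpol p z (w1 + w2) = dpol p z w1 + dpol p z w2.
Proof.
by rewrite -[RHS]big_split; apply: eq_bigr => k _; rewrite !mxE mulrDr.
Qed.

Lemma dpolZ p z c w : dpol p z (c *: w) = c * dpol p z w.
Proof.
by rewrite /dpol mulr_sumr; apply: eq_bigr => k _; rewrite !mxE mulrCA.
Qed.

(** The derivative is read off as a coefficient of the restriction of [p] to a line. This property
    passes to sums and products, so constants and coordinates suffice. *)
Let good (z w : 'rV[R[i]]_m) p := exists2 q : {poly R[i]},
  forall t, evalp p (z + t *: w) = q.[t] & q`_1 = dpol p z w.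

Let good_add z w p1 p2 : good z w p1 -> good z w p2 -> good z w (p1 + p2).
Proof.
move=> [q1 e1 d1] [q2 e2 d2]; exists (q1 + q2) => [t|].
  by rewrite hornerD -e1 -e2 /evalp mpoly.mevalD.
rewrite coefD d1 d2 -[LHS]big_split; apply: eq_bigr => k _.
by rewrite !mxE /evalp mpoly.mderivD mpoly.mevalD mulrDl.
Qed.

Let good_mul z w p1 p2 : good z w p1 -> good z w p2 -> good z w (p1 * p2).
Proof.
move=> [q1 e1 d1] [q2 e2 d2]; exists (q1 * q2) => [t|].
  by rewrite hornerM -e1 -e2 /evalp mpoly.mevalM.
rewrite coefM big_ord_recl big_ord1 /= d1 d2.
have -> : q1`_0 = evalp p1 z by rewrite -horner_coef0 -e1 scale0r addr0.
have -> : q2`_0 = evalp p2 z by rewrite -horner_coef0 -e2 scale0r addr0.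
rewrite [_ * dpol _ _ _]mulr_sumr [dpol _ _ _ * _]mulr_suml -[LHS]big_split; apply: eq_bigr => k _.
rewrite !mxE /evalp mpoly.mderivM mpoly.mevalD !mpoly.mevalM.
by rewrite addrC mulrDl mulrA -(mulrA _ (mpoly.meval _ p2)) (mulrC (mpoly.meval _ p2)) mulrA.
Qed.

Let good_cst z w c : good z w (mpoly.mpolyC m c).
Proof.
exists c%:P => [t|]; first by rewrite hornerC /evalp mpoly.mevalC.
rewrite coefC /= /dpol big1 // => k _.
by rewrite !mxE /evalp mpoly.mderivC mpoly.meval0 mul0r.
Qed.

Let good_X z w k : good z w (mpoly.mpolyX R[i] (mpoly.mnm1 k)).
Proof.
exists ((z 0 k)%:P + (w 0 k)%:P * 'X) => [t|].
  by rewrite /evalp mpoly.mevalXU !mxE !hornerE mulrC.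
rewrite coefD coefC coefCM coefX /= add0r mulr1 /dpol (bigD1 k) //= big1.
  rewrite !mxE /evalp mpoly.mderivX mpoly.mnm1E eqxx scale1r.
  have -> : mpoly.mnm_sub (mpoly.mnm1 k) (mpoly.mnm1 k) = mpoly.mnm0 :> mpoly.multinom m.
    by apply/mpoly.mnmP => j; rewrite mpoly.mnmBE subnn mpoly.mnm0E.
  by rewrite mpoly.mpolyX0 mpoly.meval1 mul1r addr0.
move=> l lk; rewrite !mxE /evalp mpoly.mderivX mpoly.mnm1E.
by rewrite eq_sym (negbTE lk) scale0r mpoly.meval0 mul0r.
Qed.

Lemma evalp_line p (z w : 'rV[R[i]]_m) : good z w p.
Proof.
rewrite [p]mpoly.mpolyE; apply: big_ind => [|p1 p2|mm _].
- by have := good_cst z w 0; rewrite mpoly.mpolyC0.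
- exact: good_add.
rewrite -mpoly.mul_mpolyC; apply: good_mul; first exact: good_cst.
rewrite mpoly.mpolyXE_id; apply: big_ind => [|p1 p2|k _].
- by have := good_cst z w 1; rewrite mpoly.mpolyC1.
- exact: good_mul.
elim: (mm k) => [|j IH].
  by have := good_cst z w 1; rewrite mpoly.mpolyC1 expr0.
by rewrite exprS; apply: good_mul => //; exact: good_X.
Qed.

(** Serves to differentiate polynomials that are known only through their values, by expanding these
    values along a line. *)
Lemma dpol_line p (z w : 'rV[R[i]]_m) (q : {poly R[i]}) :
  (forall t, evalp p (z + t *: w) = q.[t]) -> dpol p z w = q`_1.
Proof.
move=> e; have [q' e' <-] := evalp_line p z w.
by rewrite (poly_eqfun (p := q) (q := q')) // => t; rewrite -e -e'.
Qed.

End DirectionalDerivative.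

(** * Rank factorizations, local equations and local frames *)

Lemma full_rank_factorization (F : fieldType) (m r q : nat) (A : 'M[F]_(m, r)) :
  \rank A = q ->
  exists (L : 'M[F]_(m, q)) (B : 'M[F]_(q, r)) (C : 'M[F]_(r, q)),
    [/\ A = L *m B, B *m C = 1%:M & \rank L = q].
Proof.
move=> <-; exists (col_base A), (row_base A), (pinvmx (row_base A)).
split; first by rewrite mulmx_base.
  by rewrite mulmxVp // row_base_free.
by apply/eqP; rewrite -/(row_full _) col_base_full.
Qed.

Lemma mxtrace_idempotent (F : fieldType) (m : nat) (A : 'M[F]_m) :
  A *m A = A -> \tr A = (\rank A)%:R.
Proof.
move=> AA; move: (erefl (\rank A)); move: {-1}(\rank A) => q rA.
have [L [B [C [defA BC rL]]]] := full_rank_factorization rA.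
have [L' L'L] : exists L' : 'M[F]_(q, m), L' *m L = 1%:M.
  by apply/row_fullP; rewrite /row_full rL.
(* In [L B L B = L B], the factor [L] cancels on the left and [B] on the right; the trace of [A] is
   then that of an identity matrix of size [q]. *)
have BL : B *m L = 1%:M.
  have /(congr1 (fun X => L' *m X *m C)) := AA.
  rewrite {1 2 3}defA !mulmxA L'L mul1mx -!mulmxA BC mulmx1.
  by rewrite ?mulmxA ?L'L ?mul1mx ?BC.
by rewrite {1}defA mxtrace_mulC BL mxtrace1.
Qed.

Section LocalEquations.
Variables (R : realType) (m : nat).

Definition jacp (r : nat) (F : 'I_r -> mpoly.mpoly m R[i]) (z : 'rV[R[i]]_m) :
  'M[R[i]]_(m, r) := \matrix_(i, j) gradp (F j) z 0 i.

Lemma mul_jacp r (F : 'I_r -> mpoly.mpoly m R[i]) z w :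
  w *m jacp F z = \row_j dpol (F j) z w.
Proof.
apply/rowP => j; rewrite !mxE; apply: eq_bigr => k _.
by rewrite [jacp _ _ _ _]mxE mulrC.
Qed.

(* The equations [F] are redundant; the syzygies [K] say which linear
   combinations [F *m C] of them already define [Z] near [z0]. *)
Lemma local_equations (N r s : nat) (Z : set 'rV[R[i]]_m) (z0 : 'rV[R[i]]_m)
    (F : 'I_r -> mpoly.mpoly m R[i]) (K : 'rV[R[i]]_m -> 'M[R[i]]_(r, s))
    (h0 : 'rV[R[i]]_m -> R[i]) :
  polymx K -> polyfun h0 -> h0 z0 != 0 ->
  (forall z, h0 z != 0 -> (Z z <-> forall j, evalp (F j) z = 0)) ->
  (forall z, (\row_j evalp (F j) z) *m K z = 0) ->
  (forall x : 'rV_r, x *m K z0 = 0 -> exists w, x = w *m jacp F z0) ->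
  \rank (jacp F z0) = (m - N)%N ->
  exists (h : mpoly.mpoly m R[i]) (G : 'I_(m - N) -> mpoly.mpoly m R[i]),
    [/\ evalp h z0 != 0,
        forall z, evalp h z != 0 -> (Z z <-> forall j, evalp (G j) z = 0) &
        row_free (\matrix_(j < m - N) gradp (G j) z0)].
Proof.
move=> hK h0p h00 hZ FK exact rJ.
have [L [B [C [defJ BC rL]]]] := full_rank_factorization rJ.
(* A row [x] killed by [K z0] is a value [w *m jacp F z0] of the differential, and [C] is injective
   on these values because [B *m C = 1]. *)
have free0 : row_free (row_mx C (K z0)).
  apply: inj_row_free => x; rewrite mul_mx_row -[0]row_mx0 => /eq_row_mx[xC].
  move=> /exact[w ex]; move: xC; rewrite ex defJ mulmxA -(mulmxA _ B) BC mulmx1.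
  by move=> ->; rewrite mul0mx.
have [V hV] := row_freeP free0.
(* Where this determinant is nonzero, [F *m C = 0] and the syzygy [F *m K = 0] together force
   [F = 0]. At [z0] it equals 1 by the choice of [V]. *)
have : polyfun (fun z => h0 z * \det (row_mx C (K z) *m V)).
  apply: polyfunM => //; apply: polyfun_det; apply: polymxM; last exact: polymx_cst.
  by apply: polymx_row_mx => //; exact: polymx_cst.
move=> [h hh]; exists h, (fun j => \sum_k mpoly.mpolyC m (C k j) * F k).
have evG z j : evalp (\sum_k mpoly.mpolyC m (C k j) * F k) z =
    ((\row_j evalp (F j) z) *m C) 0 j.
  rewrite /evalp raddf_sum /= mxE; apply: eq_bigr => k _.
  by rewrite mpoly.mevalM mpoly.mevalC mxE mulrC.
split; first by rewrite hh hV det1 mulr1.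
  move=> z; rewrite hh mulf_eq0 negb_or => /andP[h0z dz]; split.
    move/(hZ z h0z) => Fz j; rewrite evG mxE big1 // => k _.
    by rewrite mxE Fz mul0r.
  move=> Gz; apply/(hZ z h0z).
  have FC : (\row_j evalp (F j) z) *m C = 0.
    by apply/rowP => j; rewrite -evG Gz mxE.
  have : (\row_j evalp (F j) z) *m (row_mx C (K z) *m V) = 0.
    by rewrite mulmxA mul_mx_row FC FK row_mx0 mul0mx.
  move/(congr1 (mulmx^~ (invmx (row_mx C (K z) *m V)))).
  rewrite mul0mx mulmxK ?unitmxE ?unitfE // => F0 j.
  by have /rowP/(_ j) := F0; rewrite !mxE.
have -> : \matrix_(j < m - N) gradp (\sum_k mpoly.mpolyC m (C k j) * F k) z0 =
    (jacp F z0 *m C)^T.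
  apply/matrixP => j i; rewrite !mxE /evalp (raddf_sum (mpoly.mderiv i)) raddf_sum /=.
  apply: eq_bigr => k _.
  rewrite mpoly.mderivM mpoly.mderivC mul0r add0r mpoly.mevalM mpoly.mevalC.
  by rewrite !mxE mulrC.
by rewrite /row_free mxrank_tr defJ -mulmxA BC mulmx1 rL.
Qed.

End LocalEquations.

Section ImageDistribution.
Variables (R : realType) (m : nat).

Definition rowvs (q : nat) (M : 'M[R[i]]_(q, m)) : {vspace 'rV[R[i]]_m} :=
  limg (linfun (mulmxr M)).

Lemma rowvsP q (M : 'M[R[i]]_(q, m)) w : w \in rowvs M <-> (w <= M)%MS.
Proof.
split; first by move=> /memv_imgP[u _ ->]; rewrite lfunE /= submxMl.
by move=> /submxP[u ->]; apply/memv_imgP; exists u; rewrite ?memvf // lfunE.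
Qed.

Lemma basis_of_rowvs p q (B : 'M[R[i]]_(p, m)) (M : 'M[R[i]]_(q, m)) :
  row_free B -> (B :=: M)%MS ->
  basis_of (rowvs M) [tuple row j B | j < p].
Proof.
move=> fB eBM.
have sum_row (c : 'I_p -> R[i]) :
    \sum_j c j *: [tuple row j B | j < p]`_j = (\row_j c j) *m B.
  rewrite mulmx_sum_row; apply: eq_bigr => j _.
  by rewrite -tnth_nth tnth_mktuple mxE.
rewrite /basis_of; apply/andP; split; last first.
  apply/freeP => c; rewrite sum_row => /(congr1 (mulmx^~ (pinvmx B))).
  rewrite mul0mx -mulmxA mulmxVp // mulmx1 => /rowP c0 j.
  by have := c0 j; rewrite !mxE.
rewrite eqEsubv; apply/andP; split; apply/subvP => w.
  move/coord_span => ->; rewrite sum_row; apply/rowvsP.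
  by rewrite -eBM submxMl.
move/rowvsP; rewrite -eBM => /submxP[u ->]; rewrite mulmx_sum_row.
apply: memv_suml => j _; apply: memvZ; apply: memv_span.
by apply/tnthP; exists j; rewrite tnth_mktuple.
Qed.

(** The frame consists of the rows of [B *m M z], where the rows of [B] are a basis of the image of
    [M z0]. Since [M z0] is idempotent it fixes [B], so [\det (B *m M z *m C)] is 1 at [z0]; where
    it is nonzero the rows are free, and they span because the rank of [M z] is constant. *)
Lemma local_frame (p : nat) (Z : set 'rV[R[i]]_m)
    (M : 'rV[R[i]]_m -> 'M[R[i]]_m) (z0 : 'rV[R[i]]_m) :
  polymx M -> (forall z, Z z -> M z *m M z = M z) ->
  (forall z, Z z -> \rank (M z) = p) -> Z z0 ->
  exists (h : mpoly.mpoly m R[i]) (e : 'I_p -> 'I_m -> mpoly.mpoly m R[i]),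
    evalp h z0 != 0 /\
    forall z, Z z -> evalp h z != 0 ->
      basis_of (rowvs (M z))
        [tuple (\row_i evalp (e j i) z : 'rV[R[i]]_m) | j < p].
Proof.
move=> hM idM rM Z0.
have [L [B [C [defM BC rL]]]] := full_rank_factorization (rM _ Z0).
have BM : B *m M z0 = B.
  have /row_fullP[L' L'L] : row_full L by rewrite /row_full rL.
  have -> : B = L' *m M z0 by rewrite defM mulmxA L'L mul1mx.
  by rewrite -mulmxA idM.
have hB : polymx (fun z => B *m M z) by apply: polymxM => //; exact: polymx_cst.
have [e he] : exists e : 'I_p -> 'I_m -> mpoly.mpoly m R[i],
    forall j i z, evalp (e j i) z = (B *m M z) j i.
  have /choice[e he] : forall ji : 'I_p * 'I_m,
      exists q, forall z, evalp q z = (B *m M z) ji.1 ji.2.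
    by move=> [j i]; exact: hB.
  by exists (fun j i => e (j, i)) => j i z; exact: he (j, i) z.
have [h hh] : polyfun (fun z => \det (B *m M z *m C)).
  by apply: polyfun_det; apply: polymxM => //; exact: polymx_cst.
exists h, e; split; first by rewrite hh BM BC det1 oner_neq0.
move=> z Zz; rewrite hh => dz.
have -> : [tuple (\row_i evalp (e j i) z : 'rV[R[i]]_m) | j < p] =
    [tuple row j (B *m M z) | j < p].
  apply: eq_from_tnth => j; rewrite !tnth_mktuple.
  by apply/rowP => i; rewrite !mxE he mxE.
have fB : row_free (B *m M z).
  apply: inj_row_free => x x0.
  have : x *m (B *m M z *m C) = 0 by rewrite mulmxA x0 mul0mx.
  move/(congr1 (mulmx^~ (invmx (B *m M z *m C)))).
  by rewrite mul0mx mulmxK // unitmxE unitfE.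
apply: basis_of_rowvs => //; apply/eqmxP.
by rewrite -(geq_leqif (mxrank_leqif_eq (submxMl _ _))) (eqP fB) rM.
Qed.

End ImageDistribution.

(** * Matrices with j^3 + j = 0 *)

Section Projectors.
Variables (F : numClosedFieldType) (a : nat).
Implicit Types (j W X : 'M[F]_a) (c d : F).

Definition roots3 : seq F := [:: 0; 'i; - 'i].

Lemma roots3_sqr c : c \in roots3 -> c ^+ 3 = - c.
Proof.
rewrite !inE => /or3P[]/eqP->; first by rewrite expr0n oppr0.
  by rewrite exprS sqrCi mulrN1.
by rewrite exprS sqrrN sqrCi mulrN1.
Qed.

Lemma roots3_simple c : c \in roots3 -> 3 * c ^+ 2 + 1 != 0.
Proof.
rewrite !inE => /or3P[]/eqP->; first by rewrite expr0n mulr0 add0r oner_neq0.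
  by rewrite sqrCi (_ : _ + _ = - 2%:R) ?oppr_eq0 ?pnatr_eq0 //; ring.
by rewrite sqrrN sqrCi (_ : _ + _ = - 2%:R) ?oppr_eq0 ?pnatr_eq0 //; ring.
Qed.

Lemma roots3_uniq : uniq roots3.
Proof.
have i0 := neq0Ci F.
rewrite /roots3 /= !inE negb_or andbT ![0 == _]eq_sym oppr_eq0 i0 /=.
by rewrite -addr_eq0 -mulr2n mulrn_eq0.
Qed.

(** The left-hand side is the divided difference of [X^3 + X] at two roots. On the diagonal it
    becomes the derivative, nonzero by [roots3_simple]; this contrast governs the differential of
    [j^3 + j] block by block. *)
Lemma roots3_diff c d : c \in roots3 -> d \in roots3 -> c != d ->
  c ^+ 2 + c * d + d ^+ 2 + 1 = 0.
Proof.
move=> /roots3_sqr c3 /roots3_sqr d3 cd.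
apply: (mulfI (x := c - d)); first by rewrite subr_eq0.
by rewrite mulr0; ring: c3 d3.
Qed.

(* [(X^3 + X) / (X - c)] is [X^2 + c X + (c^2 + 1)], with value [3 c^2 + 1] at
   [c]. *)
Definition eproj c j : 'M[F]_a :=
  (3 * c ^+ 2 + 1)^-1 *: (j *m j + c *: j + (c ^+ 2 + 1)%:M).

Variable j : 'M[F]_a.
Hypothesis j3 : j *m j *m j + j = 0.

Let j3' : j *m j *m j = - j. Proof. by apply/eqP; rewrite -addr_eq0 j3. Qed.

Lemma mul_eproj c : c \in roots3 -> j *m eproj c j = c *: eproj c j.
Proof.
move=> hc; have c3 := roots3_sqr hc.
rewrite /eproj -scalemxAr scalerA [c * _]mulrC -scalerA; congr (_ *: _).
rewrite !mulmxDr mulmxA j3' -scalemxAr mul_mx_scalar -scalemx1.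
apply/matrixP => u v; rewrite !mxE; move: (\sum_k _) (_ == _) => x b.
by ring: c3.
Qed.

Lemma eproj_mul c : c \in roots3 -> eproj c j *m j = c *: eproj c j.
Proof.
move=> hc; have c3 := roots3_sqr hc.
rewrite /eproj -scalemxAl scalerA [c * _]mulrC -scalerA; congr (_ *: _).
rewrite !mulmxDl j3' -scalemxAl mul_scalar_mx -scalemx1.
apply/matrixP => u v; rewrite !mxE; move: (\sum_k _) (_ == _) => x b.
by ring: c3.
Qed.

(** As [j] acts on [eproj d j] as the scalar [d], the polynomial that defines [eproj c] is merely
    evaluated at [d]: this gives the derivative if [c = d] and the divided difference otherwise. *)
Lemma eprojM c d : c \in roots3 -> d \in roots3 ->
  eproj c j *m eproj d j = if c == d then eproj d j else 0.
Proof.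
move=> hc hd; have := mul_eproj hd; move: (eproj d j) => Q jQ.
rewrite /eproj -scalemxAl !mulmxDl -mulmxA -scalemxAl !jQ -scalemxAr jQ.
rewrite mul_scalar_mx; apply/matrixP => u v; case: (eqVneq c d) => [->|cd].
  rewrite !mxE [X in _ * X](_ : _ = (3 * d ^+ 2 + 1) * Q u v); last by ring.
  by rewrite mulKf // roots3_simple.
rewrite !mxE [X in _ * X](_ : _ = (c ^+ 2 + c * d + d ^+ 2 + 1) * Q u v).
  by rewrite roots3_diff // mul0r mulr0.
by ring.
Qed.

Lemma sum_eproj : \sum_(c <- roots3) eproj c j = 1%:M.
Proof.
rewrite !big_cons big_nil /eproj; move: (j *m j) => Y.
apply/matrixP => u v; rewrite !mxE !sqrrN sqrCi expr0n /=.
by move: (_ == _) 'i => b w; field.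
Qed.

Lemma mxtrace_eproj c : \tr (eproj c j) =
  (3 * c ^+ 2 + 1)^-1 * (\tr (j *m j) + c * \tr j + (c ^+ 2 + 1) * a%:R).
Proof. by rewrite /eproj mxtraceZ !mxtraceD mxtraceZ mxtrace_scalar mulr_natr. Qed.

(** The traces of [1], [j] and [j^2] determine those of the three projectors, which are the
    multiplicities of the eigenvalues. *)
Lemma mxtrace_eproj_roots n : \tr j = 0 -> \tr (j *m j) = - (n.*2)%:R ->
  [/\ \tr (eproj 0 j) = a%:R - (n.*2)%:R,
      \tr (eproj 'i j) = n%:R & \tr (eproj (- 'i) j) = n%:R].
Proof.
move=> t1 t2; rewrite !mxtrace_eproj t1 t2 -muln2 natrM !sqrrN sqrCi expr0n /=.
by split; field.
Qed.

(** This sum of squared multiplicities is the dimension of the commutant of [j], hence the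
    codimension of its conjugacy class. *)
Lemma sum_mxtrace_eproj n : (n.*2 <= a)%N ->
  \tr j = 0 -> \tr (j *m j) = - (n.*2)%:R ->
  \sum_(c <- roots3) \tr (eproj c j) ^+ 2 =
  (n ^ 2 + n ^ 2 + (a - n.*2) ^ 2)%:R.
Proof.
move=> na t1 t2; have [e0 e1 e2] := mxtrace_eproj_roots t1 t2.
rewrite !big_cons big_nil e0 e1 e2 !natrD !natrX natrB // addr0.
by rewrite addrC.
Qed.

Lemma eproj_decomp W :
  W = \sum_(c <- roots3) \sum_(d <- roots3) eproj c j *m W *m eproj d j.
Proof.
under eq_bigr do rewrite -mulmx_sumr sum_eproj mulmx1.
by rewrite -mulmx_suml sum_eproj mul1mx.
Qed.

(** The projection of matrices onto the commutant of [j], that is, onto the block-diagonal matrices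
    of its spectral decomposition. *)
Definition diagpart W := \sum_(c <- roots3) eproj c j *m W *m eproj c j.

Lemma eproj_diagpart c d W : c \in roots3 -> d \in roots3 ->
  eproj c j *m diagpart W *m eproj d j =
  if c == d then eproj c j *m W *m eproj c j else 0.
Proof.
move=> hc hd; rewrite /diagpart mulmx_sumr mulmx_suml (bigD1_seq c) ?roots3_uniq //=.
rewrite big_seq_cond big1 ?addr0 => [|b /andP[hb bc]].
  rewrite !mulmxA eprojM // eqxx -!mulmxA eprojM //.
  by case: (eqVneq c d) => [->//|_]; rewrite !mulmx0.
by rewrite !mulmxA eprojM // eq_sym (negbTE bc) !mul0mx.
Qed.

Lemma diagpartB W X : diagpart (W - X) = diagpart W - diagpart X.
Proof.
rewrite /diagpart -sumrB; apply: eq_bigr => c _; move: (eproj c j) => P.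
by rewrite mulmxBr mulmxBl.
Qed.

Lemma diagpart_idem W : diagpart (diagpart W) = diagpart W.
Proof.
rewrite {1}/diagpart; apply: eq_big_seq => c hc.
by rewrite eproj_diagpart // eqxx.
Qed.

(** The differential of [j^3 + j] in the direction [W]. *)
Definition cubic_diff W := j *m j *m W + j *m W *m j + W *m j *m j + W.

Lemma eproj_cubic_diff c d W : c \in roots3 -> d \in roots3 ->
  eproj c j *m cubic_diff W *m eproj d j =
  (c ^+ 2 + c * d + d ^+ 2 + 1) *: (eproj c j *m W *m eproj d j).
Proof.
move=> hc hd; have := mul_eproj hd; have := eproj_mul hc.
rewrite /cubic_diff; move: (eproj c j) (eproj d j) => A B Aj jB.
have jL Y : A *m (j *m Y) = c *: (A *m Y) by rewrite mulmxA Aj -scalemxAl.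
have jR Y : Y *m j *m B = d *: (Y *m B) by rewrite -mulmxA jB -scalemxAr.
rewrite !mulmxDr !mulmxDl -![j *m _ *m _]mulmxA !jL -!scalemxAl.
rewrite (mulmxA A W j) jR (mulmxA A _ j) (mulmxA A W j) !jR.
by apply/matrixP => u v; rewrite !mxE; ring.
Qed.

(** The differential multiplies the block [(c, d)] of [W] by the divided difference at [c] and [d],
    which is nonzero exactly when [c = d]: its kernel is made of the off-diagonal blocks. *)
Lemma cubic_diff_eq0 W : cubic_diff W = 0 <-> diagpart W = 0.
Proof.
split=> [W0|W0].
  rewrite /diagpart big_seq big1 // => c hc.
  have := eproj_cubic_diff W hc hc; rewrite W0 mulmx0 mul0mx => /esym/eqP.
  rewrite scaler_eq0 => /orP[|/eqP//].
  rewrite (_ : _ + _ = 3 * c ^+ 2 + 1); last by ring.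
  by rewrite (negbTE (roots3_simple hc)).
rewrite [LHS]eproj_decomp big_seq big1 // => c hc.
rewrite big_seq big1 // => d hd; rewrite eproj_cubic_diff //.
case: (eqVneq c d) => [<-|cd]; last by rewrite roots3_diff // scale0r.
have := eproj_diagpart W hc hc.
by rewrite W0 mulmx0 mul0mx eqxx => <-; rewrite scaler0.
Qed.

(** On the commutant the differential is multiplication by [3 j^2 + 1], whose inverse modulo
    [j^3 + j] is [1 + (3/2) j^2]. *)
Lemma cubic_diff_commute X : j *m X = X *m j ->
  cubic_diff (X + (3 / 2) *: (j *m j *m X)) = X.
Proof.
move=> jX.
have jjX : j *m j *m X = X *m j *m j by rewrite -mulmxA !jX mulmxA jX.
have j4X : j *m j *m (j *m j *m X) = - (j *m j *m X).
  by rewrite !mulmxA j3' !mulNmx.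
have E1 : j *m X *m j = j *m j *m X by rewrite -mulmxA -jX mulmxA.
rewrite /cubic_diff !mulmxDr !mulmxDl -!scalemxAr -!scalemxAl.
have -> : j *m (j *m j *m X) *m j = - (j *m j *m X).
  by rewrite -!mulmxA -jX !mulmxA j3' !mulNmx.
have -> : j *m j *m X *m j *m j = - (j *m j *m X).
  by rewrite -!mulmxA (mulmxA X) -jjX !mulmxA j3' !mulNmx.
rewrite j4X E1 -jjX; move: (j *m j *m X) => Y.
by apply/matrixP => u v; rewrite !mxE; field.
Qed.

(** In the expansion of the cube plus the identity, the coefficient of [t] is the divided difference
    times [X], and the higher ones contain [X X] or [X j X], which both vanish. The square is
    recorded for the trace of [j^2]. *)
Lemma cubic_line X c d (t : F) : c \in roots3 -> d \in roots3 -> c != d ->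
  j *m X = c *: X -> X *m j = d *: X -> X *m X = 0 ->
  (j + t *: X) *m (j + t *: X) = j *m j + (t * (c + d)) *: X /\
  (j + t *: X) *m (j + t *: X) *m (j + t *: X) + (j + t *: X) = 0.
Proof.
move=> hc hd cd jX Xj XX.
have E : (j + t *: X) *m (j + t *: X) = j *m j + (t * (c + d)) *: X.
  rewrite mulmxDl !mulmxDr -!scalemxAl -!scalemxAr jX Xj XX.
  by apply/matrixP => u v; rewrite !mxE; ring.
split=> //; rewrite E mulmxDl !mulmxDr -!scalemxAl -!scalemxAr Xj XX.
rewrite -[j *m j *m X]mulmxA jX -scalemxAr jX j3'.
have e : c ^+ 2 = - (c * d) - d ^+ 2 - 1.
  by apply/eqP; rewrite -subr_eq0 -(roots3_diff hc hd cd); apply/eqP; ring.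
by apply/matrixP => u v; rewrite !mxE; ring: e.
Qed.

End Projectors.

(** * The variety, its tangent spaces and its dimension *)

Lemma mxtrace_lin_mx (F : fieldType) (a : nat) (f : {linear 'M[F]_a -> 'M[F]_a}) :
  \tr (lin_mx f) = \sum_k \sum_l f (delta_mx k l) k l.
Proof.
rewrite /mxtrace pair_big (reindex (fun p : 'I_a * 'I_a => mxvec_index p.1 p.2)) /=.
  by apply: eq_bigr => -[k l] _; rewrite !mxE /= vec_mx_delta mxvecE.
exists (fun k => ((enum_val (cast_ord (esym (mxvec_cast a a)) k)))) => /= [[k l] _|k _].
  by rewrite /mxvec_index cast_ordK enum_rankK.
by rewrite /mxvec_index -surjective_pairing enum_valK cast_ordKV.
Qed.

Lemma algebraic_set_polymx (R : realType) (m r : nat)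
    (g : 'rV[R[i]]_m -> 'rV[R[i]]_r) :
  polymx g -> algebraic_set [set z | g z = 0].
Proof.
move=> hg; have /choice[F hF] := hg 0; exists r, F.
apply/seteqP; split=> z /= hz; first by move=> j; rewrite hF hz mxE.
by apply/rowP => j; rewrite -hF hz mxE.
Qed.

(* Coordinates [(x, j, y)]: the [e] coordinates [y] only adjust the dimension. *)
Section Variety.
Variables (R : realType) (n a e : nat).
Local Notation C := R[i].
Local Notation m := (a + a * a + e)%N.
Implicit Types (z w : 'rV[C]_m).

Definition xpart z : 'rV[C]_a := lsubmx (lsubmx z).
Definition jpart z : 'M[C]_a := vec_mx (rsubmx (lsubmx z)).
Definition ypart z : 'rV[C]_e := rsubmx z.
Definition mkpt (x : 'rV[C]_a) (j : 'M[C]_a) (y : 'rV[C]_e) : 'rV[C]_m :=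
  row_mx (row_mx x (mxvec j)) y.

Lemma mkptK z : mkpt (xpart z) (jpart z) (ypart z) = z.
Proof. by rewrite /mkpt vec_mxK !hsubmxK. Qed.
Lemma xpart_mkpt x j y : xpart (mkpt x j y) = x.
Proof. by rewrite /xpart !row_mxKl. Qed.
Lemma jpart_mkpt x j y : jpart (mkpt x j y) = j.
Proof. by rewrite /jpart row_mxKl row_mxKr mxvecK. Qed.
Lemma ypart_mkpt x j y : ypart (mkpt x j y) = y.
Proof. by rewrite /ypart row_mxKr. Qed.
Lemma mkptD x j y x' j' y' :
  mkpt x j y + mkpt x' j' y' = mkpt (x + x') (j + j') (y + y').
Proof. by rewrite /mkpt !add_row_mx linearD. Qed.
Lemma xpartD z w : xpart (z + w) = xpart z + xpart w.
Proof. by rewrite /xpart !linearD. Qed.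
Lemma xpartZ c z : xpart (c *: z) = c *: xpart z.
Proof. by rewrite /xpart !linearZ. Qed.
Lemma jpartD z w : jpart (z + w) = jpart z + jpart w.
Proof. by rewrite /jpart !linearD. Qed.
Lemma jpartZ c z : jpart (c *: z) = c *: jpart z.
Proof. by rewrite /jpart !linearZ. Qed.

Lemma polymx_jpart : polymx jpart.
Proof.
move=> k l; apply: polyfun_ext (polyfun_coord _ (lshift e (rshift a (mxvec_index k l)))).
by move=> z; rewrite !mxE.
Qed.

Lemma polymx_eproj c : polymx (fun z => eproj c (jpart z)).
Proof.
have pj := polymx_jpart.
apply: polymxZ; apply: polymxD; last exact: polymx_cst.
by apply: polymxD; [exact: polymxM|exact: polymxZ].
Qed.

Definition cubic j : 'M[C]_a := j *m j *m j + j.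

Lemma polymx_cubic : polymx (fun z => cubic (jpart z)).
Proof.
have pj := polymx_jpart.
by apply: polymxD => //; apply: polymxM => //; apply: polymxM.
Qed.

Definition eqsZ z : 'rV[C]_(a * a + 1 + 1) :=
  row_mx (row_mx (mxvec (cubic (jpart z))) (\tr (jpart z))%:M)
         (\tr (jpart z *m jpart z) + (n.*2)%:R)%:M.

Definition Zvar : set 'rV[C]_m := [set z | eqsZ z = 0].

Lemma ZvarP z : Zvar z <->
  [/\ cubic (jpart z) = 0, \tr (jpart z) = 0 &
      \tr (jpart z *m jpart z) = - (n.*2)%:R].
Proof.
rewrite /Zvar /= /eqsZ.
have -> : (0 : 'rV[C]_(a * a + 1 + 1)) = row_mx (row_mx 0 0) 0 by rewrite !row_mx0.
split.
  move=> /eq_row_mx[/eq_row_mx[j3 t1] t2]; split.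
  - by rewrite -[LHS]mxvecK j3 linear0.
  - by have := congr1 (fun A : 'M[C]_1 => A 0 0) t1; rewrite !mxE mulr1n.
  - apply/eqP; rewrite -addr_eq0; apply/eqP.
    by have := congr1 (fun A : 'M[C]_1 => A 0 0) t2; rewrite !mxE mulr1n.
by move=> [-> -> ->]; rewrite linear0 addNr raddf0.
Qed.

Lemma polymx_scalar1 (g : 'rV[C]_m -> C) :
  polyfun g -> polymx (fun z => (g z)%:M : 'M[C]_1).
Proof.
by move=> hg i j; apply: polyfun_ext hg => z; rewrite !ord1 mxE mulr1n.
Qed.

Lemma algebraic_Zvar : algebraic_set Zvar.
Proof.
have pj := polymx_jpart.
apply: algebraic_set_polymx; apply: polymx_row_mx; first apply: polymx_row_mx.
- by apply: polymx_mxvec; exact: polymx_cubic.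
- by apply: polymx_scalar1; apply: polyfun_trace.
- apply: polymx_scalar1; apply: polyfunD; last exact: polyfun_cst.
  by apply: polyfun_trace; apply: polymxM.
Qed.

(** Only the entries of [j^3 + j] become local equations; the two trace equations follow from them
    near a given point of the variety. *)
Definition pcubic : 'I_(a * a) -> mpoly.mpoly m C :=
  projT1 (choice (polymx_mxvec polymx_cubic 0)).

Lemma pcubicE k z : evalp (pcubic k) z = mxvec (cubic (jpart z)) 0 k.
Proof. by rewrite /pcubic; case: choice => p /= ->. Qed.

Lemma cubic_expand (j W : 'M[C]_a) t : cubic (j + t *: W) =
  cubic j + t *: cubic_diff j W +
  t ^+ 2 *: (j *m W *m W + W *m j *m W + W *m W *m j) +
  t ^+ 3 *: (W *m W *m W).
Proof.
rewrite /cubic /cubic_diff.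
have mZ (A B : 'M[C]_a) c : (c *: A) *m B = c *: (A *m B) by rewrite scalemxAl.
have Zm (A B : 'M[C]_a) c : A *m (c *: B) = c *: (A *m B) by rewrite scalemxAr.
rewrite !(mulmxDl, mulmxDr, mZ, Zm).
move: (j *m j *m j) (j *m j *m W) (j *m W *m j) (j *m W *m W) (W *m j *m j)
  (W *m j *m W) (W *m W *m j) (W *m W *m W) => c1 c2 c3 c4 c5 c6 c7 c8.
by apply/matrixP => k l; rewrite !mxE; ring.
Qed.

(** The derivative is the coefficient of [t] in [cubic_expand], the polynomial [q] being the
    expansion of one entry. *)
Lemma dpol_pcubic z w k :
  dpol (pcubic k) z w = mxvec (cubic_diff (jpart z) (jpart w)) 0 k.
Proof.
pose q (A B D E : 'M[C]_a) : {poly C} := (mxvec A 0 k)%:P + (mxvec B 0 k)%:P * 'X +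
  (mxvec D 0 k)%:P * 'X^2 + (mxvec E 0 k)%:P * 'X^3.
have qE A B D E t :
    mxvec (A + t *: B + t ^+ 2 *: D + t ^+ 3 *: E) 0 k = (q A B D E).[t].
  rewrite /q !hornerD !hornerCM !hornerXn hornerX hornerC.
  case/mxvec_indexP: k {q} => k l.
  by rewrite !mxvecE !mxE; move: (A k l) (B k l) (D k l) (E k l) => *; ring.
set j := jpart z; set W := jpart w.
have lE t : evalp (pcubic k) (z + t *: w) = (q (cubic j) (cubic_diff j W)
    (j *m W *m W + W *m j *m W + W *m W *m j) (W *m W *m W)).[t].
  by rewrite pcubicE jpartD jpartZ cubic_expand qE.
rewrite (dpol_line lE).
by rewrite /q !coefD !coefCM coefC coefX !coefXn /= !mulr0 mulr1 !addr0 add0r.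
Qed.

Lemma tangent_spaceD (Z : set 'rV[C]_m) z w1 w2 :
  tangent_space Z z w1 -> tangent_space Z z w2 -> tangent_space Z z (w1 + w2).
Proof.
move=> h1 h2 p hp; rewrite -/(dpol p z (w1 + w2)) dpolD.
by rewrite /dpol h1 // h2 // addr0.
Qed.

Lemma tangent_spaceZ (Z : set 'rV[C]_m) z c w :
  tangent_space Z z w -> tangent_space Z z (c *: w).
Proof.
move=> h p hp; rewrite -/(dpol p z (c *: w)) dpolZ.
by rewrite /dpol h // mulr0.
Qed.

Lemma tangent_line (Z : set 'rV[C]_m) z w :
  (forall t, Z (z + t *: w)) -> tangent_space Z z w.
Proof.
move=> h p hp; rewrite -/(dpol p z w) (dpol_line (q := 0)) ?coef0 // => t.
by rewrite hp // horner0.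
Qed.

(* An off-diagonal block [X] of a tangent vector has square zero, so that the
   line [j + t X] stays in the variety. *)
Lemma tangent_Zvar_line z w c d : Zvar z -> c \in roots3 C -> d \in roots3 C ->
  c != d -> jpart w = eproj c (jpart z) *m jpart w *m eproj d (jpart z) ->
  tangent_space Zvar z w.
Proof.
move=> /ZvarP[j3 t1 t2] hc hd cd wE; apply: tangent_line => t; apply/ZvarP.
rewrite jpartD jpartZ; set j := jpart z in j3 t1 t2 wE *.
have := eprojM j3 hd hc; have := eproj_mul j3 hd; have := mul_eproj j3 hc.
rewrite eq_sym (negbTE cd).
move: (eproj c j) (eproj d j) (jpart w) wE => P Q W wE jP Qj QP.
have jX : j *m W = c *: W by rewrite wE !mulmxA jP -!scalemxAl.
have Xj : W *m j = d *: W by rewrite wE -!mulmxA Qj -!scalemxAr.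
have XX : W *m W = 0.
  by rewrite {1}wE {2}wE !mulmxA -(mulmxA _ Q P) QP mulmx0 !mul0mx.
have trX : \tr W = 0.
  by rewrite wE mxtrace_mulC mulmxA QP mul0mx mxtrace0.
have [e2 e3] := cubic_line j3 t hc hd cd jX Xj XX.
split=> //; first by rewrite mxtraceD mxtraceZ trX t1 mulr0 addr0.
by rewrite e2 mxtraceD mxtraceZ trX mulr0 addr0.
Qed.

(** The entries of [j^3 + j] vanish on the variety, which gives one direction. Conversely the [j]
    part of [w] has no diagonal block, and each off-diagonal block is the direction of a line inside
    the variety; the [x] and [y] parts are directions of such lines too. *)
Lemma tangent_ZvarP z w : Zvar z ->
  (tangent_space Zvar z w <-> cubic_diff (jpart z) (jpart w) = 0).
Proof.
move=> Zz; have [j3 _ _] := (ZvarP z).1 Zz; split=> [tw|W0].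
  rewrite -[LHS]mxvecK (_ : mxvec _ = 0) ?linear0 //.
  apply/rowP => k; rewrite -dpol_pcubic mxE; apply: tw => y.
  by move=> /ZvarP[y3 _ _]; rewrite pcubicE y3 linear0 mxE.
have diag0 : forall c, c \in roots3 C ->
    eproj c (jpart z) *m jpart w *m eproj c (jpart z) = 0.
  move=> c hc; have := eproj_diagpart j3 (jpart w) hc hc.
  by rewrite ((cubic_diff_eq0 j3 _).1 W0) mulmx0 mul0mx eqxx.
pose v c d := mkpt 0 (eproj c (jpart z) *m jpart w *m eproj d (jpart z)) 0.
have -> : w = mkpt (xpart w) 0 (ypart w) +
    \sum_(c <- roots3 C) \sum_(d <- roots3 C) v c d.
  pose L := fun X => mkpt 0 X 0.
  have LD : {morph L : x y / x + y} by move=> x y; rewrite /L mkptD !addr0.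
  have L0 : L 0 = 0 by rewrite /L /mkpt linear0 !row_mx0.
  have -> : \sum_(c <- roots3 C) \sum_(d <- roots3 C) v c d = L (jpart w).
    rewrite [in RHS](eproj_decomp (jpart z) (jpart w)) (big_morph L LD L0).
    by apply: eq_bigr => c _; rewrite (big_morph L LD L0).
  by rewrite /L mkptD addr0 add0r addr0 mkptK.
have t0 : tangent_space Zvar z 0.
  by move=> p _; rewrite -/(dpol p z 0) -(scale0r 0) dpolZ mul0r.
have h0 : (0 : C) \in roots3 C by rewrite inE eqxx.
have hi : 'i \in roots3 C by rewrite !inE eqxx orbT.
apply: tangent_spaceD.
  (* The [j] part of this vector is zero, hence a block for any two distinct roots; 0 and [i] are an
     arbitrary choice. *)
  apply: (@tangent_Zvar_line _ _ 0 'i) => //; first by rewrite eq_sym neq0Ci.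
  by rewrite jpart_mkpt mulmx0 mul0mx.
rewrite big_seq; apply: big_ind => // [|c hc]; first exact: tangent_spaceD.
rewrite big_seq; apply: big_ind => // [|d hd]; first exact: tangent_spaceD.
have [<-|cd] := eqVneq c d; first by rewrite /v diag0 // /mkpt linear0 !row_mx0.
apply: (tangent_Zvar_line Zz hc hd cd); rewrite jpart_mkpt.
have := eprojM j3 hc hc; have := eprojM j3 hd hd; rewrite !eqxx.
move: (eproj c _) (eproj d _) => P Q QQ PP.
by rewrite !mulmxA PP -!mulmxA QQ.
Qed.

Definition diagmx (j : 'M[C]_a) : 'M[C]_(a * a) :=
  \sum_(c <- roots3 C) lin_mx (mulmxr (eproj c j) \o mulmx (eproj c j)).

Lemma mul_diagmx j (W : 'M[C]_a) : mxvec W *m diagmx j = mxvec (diagpart j W).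
Proof.
rewrite /diagmx mulmx_sumr /diagpart linear_sum; apply: eq_bigr => c _.
by rewrite mul_vec_lin.
Qed.

(** One projector serves two purposes: its row space is the tangent space for [Q = 0], and the
    distribution for [Q] the spectral projector at [i]. *)
Definition tanproj (Q : 'M[C]_a) (j : 'M[C]_a) : 'M[C]_m :=
  block_mx (block_mx (1%:M - Q) 0 0 (1%:M - diagmx j)) 0 0 1%:M.

Lemma mul_tanproj w Q j : w *m tanproj Q j =
  mkpt (xpart w *m (1%:M - Q)) (jpart w - diagpart j (jpart w)) (ypart w).
Proof.
rewrite -{1}(mkptK w) /mkpt /tanproj !mul_row_block !mulmx0 !addr0 !add0r mulmx1.
by rewrite (mulmxBr (mxvec _)) mulmx1 mul_diagmx -linearB.
Qed.

Lemma tanproj_idem Q j : cubic j = 0 -> Q *m Q = Q ->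
  tanproj Q j *m tanproj Q j = tanproj Q j.
Proof.
move=> j3 QQ; have QQ1 : (1%:M - Q) *m (1%:M - Q) = 1%:M - Q.
  by rewrite mulmxBr mulmx1 mulmxBl mul1mx QQ subrr subr0.
apply/row_matrixP => k; rewrite row_mul.
rewrite !rowE !mul_tanproj xpart_mkpt jpart_mkpt ypart_mkpt.
rewrite -mulmxA QQ1.
by rewrite diagpartB diagpart_idem // subrr subr0.
Qed.

(** The map sending [W] to [P W P] has trace [(\tr P)^2]: its diagonal entry at the elementary
    matrix [(k, l)] is [P k k * P l l]. *)
Lemma mxtrace_diagmx j :
  \tr (diagmx j) = \sum_(c <- roots3 C) \tr (eproj c j) ^+ 2.
Proof.
rewrite /diagmx raddf_sum; apply: eq_bigr => c _; move: (eproj c j) => P.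
apply: (etrans (mxtrace_lin_mx (mulmxr P \o mulmx P))) => /=.
rewrite expr2 [X in X * _]/mxtrace mulr_suml; apply: eq_bigr => k _.
rewrite mulr_sumr; apply: eq_bigr => l _.
rewrite mxE (bigD1 l) //= big1 ?addr0 => [|l' ll'].
  rewrite mxE (bigD1 k) //= big1 ?addr0 => [|k' kk'].
    by rewrite mxE !eqxx mulr1.
  by rewrite mxE (negbTE kk') mulr0.
rewrite mxE big1 ?mul0r // => k' _.
by rewrite mxE (negbTE ll') andbF mulr0.
Qed.

Lemma mxtrace_Zvar z : Zvar z ->
  [/\ \tr (eproj 0 (jpart z)) = a%:R - (n.*2)%:R,
      \tr (eproj 'i (jpart z)) = n%:R & \tr (eproj (- 'i) (jpart z)) = n%:R].
Proof.
move=> /ZvarP[_ t1 t2].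
exact: mxtrace_eproj_roots.
Qed.

Hypothesis ha : (n.*2 <= a)%N.

(** The three terms count [x], the conjugacy class of [j] and [y]. *)
Definition dimZ : nat := (a + (a * a - (n ^ 2 + n ^ 2 + (a - n.*2) ^ 2)) + e)%N.

(** The rank of an idempotent is its trace, which is additive over the diagonal blocks; the equality
    is then one of natural numbers inside a field of characteristic zero. *)
Lemma mxrank_tanproj z q Q : Zvar z -> Q *m Q = Q -> \tr Q = q%:R -> (q <= a)%N ->
  \rank (tanproj Q (jpart z)) = (dimZ - q)%N.
Proof.
move=> Zz QQ tQ qa; have [j3 t1 t2] := (ZvarP z).1 Zz.
apply/eqP; rewrite -(eqr_nat C) -mxtrace_idempotent ?tanproj_idem //.
have h : (n ^ 2 + n ^ 2 + (a - n.*2) ^ 2 <= a * a)%N by nia.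
have -> : \tr (tanproj Q (jpart z)) =
    (a - q)%:R + (a * a - (n ^ 2 + n ^ 2 + (a - n.*2) ^ 2))%:R + e%:R.
  rewrite /tanproj !mxtrace_block mxtrace1 !raddfB /= !mxtrace1 tQ mxtrace_diagmx.
  by rewrite (sum_mxtrace_eproj ha t1 t2) !natrB.
by rewrite -!natrD eqr_nat /dimZ; apply/eqP; lia.
Qed.

End Variety.

(** * Smoothness of the variety, its distribution and its real structure *)

Section VarietyGeometry.
Variables (R : realType) (n a e : nat).
Local Notation C := R[i].
Local Notation m := (a + a * a + e)%N.
Local Notation Zv := (@Zvar R n a e).
Local Notation dZ := (dimZ n a e).
Hypothesis ha : (n.*2 <= a)%N.

Lemma sub_tanproj Q (w z : 'rV[C]_m) : Zv z -> Q *m Q = Q ->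
  (w <= tanproj e Q (jpart z))%MS <->
  xpart w *m Q = 0 /\ cubic_diff (jpart z) (jpart w) = 0.
Proof.
move=> /ZvarP[j3 _ _] QQ; rewrite cubic_diff_eq0 //; split.
  move=> /submxP[u ->]; rewrite mul_tanproj xpart_mkpt jpart_mkpt.
  rewrite -mulmxA mulmxBl mul1mx QQ subrr mulmx0; split=> //.
  by rewrite diagpartB diagpart_idem // subrr.
move=> [xQ jW]; apply/submxP; exists w; rewrite mul_tanproj mulmxBr mulmx1 xQ jW.
by rewrite !subr0 mkptK.
Qed.

Lemma sum_sqr_le : (n ^ 2 + n ^ 2 + (a - n.*2) ^ 2 <= a * a)%N.
Proof. by nia. Qed.

Lemma affine_Zvar : affine_algebraic_manifold dZ Zv.
Proof.
have le := sum_sqr_le.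
split; [by rewrite /dimZ; lia|exact: algebraic_Zvar|].
move=> z0 Z0; have [j03 t1 t2] := (ZvarP n z0).1 Z0.
(* [Rm] is the identity at [z0] and intertwines [j] with [j0] whenever both satisfy the cubic
   equation. Where it is invertible, [j] is therefore conjugate to [j0], and the two trace equations
   hold automatically. *)
pose Rm (z : 'rV[C]_m) := \sum_(c <- roots3 C) eproj c (jpart z) *m eproj c (jpart z0).
(* The commutator with [j]: it kills [j^3 + j], which provides the syzygies. *)
pose K (z : 'rV[C]_m) := lin_mx (mulmx (jpart z)) - lin_mx (mulmxr (jpart z)).
have FK (j : 'M[C]_a) (z : 'rV[C]_m) :
    mxvec j *m K z = mxvec (jpart z *m j - j *m jpart z).
  by rewrite /K mulmxBr !mul_vec_lin /= linearB.
have pj := @polymx_jpart R a e.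
have kerJ (w : 'rV[C]_m) :
    (w *m jacp (@pcubic R a e) z0 == 0) = (cubic_diff (jpart z0) (jpart w) == 0).
  rewrite mul_jacp (_ : \row_j _ = mxvec (cubic_diff (jpart z0) (jpart w))).
    apply/eqP/eqP => [W0|->]; last by rewrite linear0.
    by rewrite -[LHS]mxvecK W0 linear0.
  by apply/rowP => k; rewrite mxE dpol_pcubic.
apply: (local_equations (F := @pcubic R a e) (K := K) (h0 := fun z => \det (Rm z))).
- apply: polymxD; last apply: polymxN; apply: polymx_lin => W.
    by apply: polymxM => //; exact: polymx_cst.
  by apply: polymxM => //; exact: polymx_cst.
- apply: polyfun_det => i j.
  apply: (@polyfun_ext _ _
    (fun z => \sum_(c <- roots3 C) (eproj c (jpart z) *m eproj c (jpart z0)) i j)).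
    by move=> z; rewrite summxE.
  apply: polyfun_sum => c; apply: polymxM; [exact: polymx_eproj|exact: polymx_cst].
- rewrite (_ : Rm z0 = 1%:M) ?det1 ?oner_neq0 // -(sum_eproj (jpart z0)).
  by apply: eq_big_seq => c hc; rewrite eprojM // eqxx.
- move=> z dR; split=> [/ZvarP[j3 _ _] k|pz].
    by rewrite pcubicE j3 linear0 mxE.
  have j3 : cubic (jpart z) = 0.
    rewrite -[LHS]mxvecK (_ : mxvec _ = 0) ?linear0 //.
    by apply/rowP => k; rewrite -pcubicE pz mxE.
  have jR : jpart z *m Rm z = Rm z *m jpart z0.
    rewrite mulmx_sumr mulmx_suml; apply: eq_big_seq => c hc.
    have := eproj_mul j03 hc; have := mul_eproj j3 hc.
    move: (eproj c _) (eproj c _) => P P0 jP P0j.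
    by rewrite mulmxA jP -mulmxA P0j -scalemxAl -scalemxAr.
  have uR : Rm z \in unitmx by rewrite unitmxE unitfE.
  have jE : jpart z = Rm z *m jpart z0 *m invmx (Rm z) by rewrite -jR mulmxK.
  apply/ZvarP; split=> //; first by rewrite jE mxtrace_mulC mulKmx.
  have -> : jpart z *m jpart z =
      Rm z *m (jpart z0 *m jpart z0) *m invmx (Rm z).
    by rewrite mulmxA -jR -(mulmxA _ (Rm z)) -jR mulmxA mulmxK.
  by rewrite mxtrace_mulC mulKmx.
- move=> z; rewrite (_ : \row_j _ = mxvec (cubic (jpart z))).
    rewrite FK /cubic mulmxDr mulmxDl !mulmxA.
    by rewrite [X in mxvec X](_ : _ = 0) ?linear0 // subrr.
  by apply/rowP => k; rewrite mxE pcubicE.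
(* Exactness at [z0]: a matrix commuting with [j0] is a value of the differential, with the preimage
   given by [cubic_diff_commute]. *)
- move=> x; rewrite -(vec_mxK x) FK => /(congr1 vec_mx); rewrite mxvecK linear0.
  move=> /eqP; rewrite subr_eq0 => /eqP cm.
  exists (mkpt 0 (vec_mx x + (3 / 2) *: (jpart z0 *m jpart z0 *m vec_mx x)) 0).
  apply/rowP => k; rewrite mul_jacp mxE dpol_pcubic jpart_mkpt.
  by rewrite cubic_diff_commute.
(* The kernel of the Jacobian is the row space of [tanproj] with [Q = 0], of rank [dimZ]. *)
- have rk := @mxrank_tanproj R n a e ha z0 0 0 Z0 (mulmx0 _ _) (mxtrace0 _ _) isT.
  rewrite subn0 in rk.
  rewrite -rk; have -> : \rank (tanproj e 0 (jpart z0)) =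
      \rank (kermx (jacp (@pcubic R a e) z0)).
    apply/eqP; rewrite eqn_leq; apply/andP; split; apply: mxrankS; apply/rV_subP => w.
      move=> /(sub_tanproj _ Z0 (mulmx0 _ _))[_ W0].
      by apply/sub_kermxP/eqP; rewrite kerJ W0.
    move=> /sub_kermxP/eqP; rewrite kerJ => /eqP W0.
    by apply/(sub_tanproj _ Z0 (mulmx0 _ _)); rewrite mulmx0.
  by rewrite mxrank_ker subKn // rank_leq_row.
Qed.

Definition Dvar (z : 'rV[C]_m) : {vspace 'rV[C]_m} :=
  rowvs (tanproj e (eproj 'i (jpart z)) (jpart z)).

Lemma roots3_i : ('i : C) \in roots3 C.
Proof. by rewrite !inE eqxx orbT. Qed.

Lemma DvarP z w : Zv z -> (w \in Dvar z <->
  xpart w *m eproj 'i (jpart z) = 0 /\ tangent_space Zv z w).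
Proof.
move=> Zz; have [j3 _ _] := (ZvarP n z).1 Zz.
by rewrite rowvsP tangent_ZvarP // sub_tanproj // eprojM // ?roots3_i // eqxx.
Qed.

Lemma distribution_Dvar : algebraic_distribution dZ n Zv Dvar.
Proof.
have le := sum_sqr_le; have na : (n <= a)%N by lia.
split; first by rewrite /dimZ; lia.
  by move=> z w Zz /(DvarP _ Zz)[].
move=> z0 Z0.
have QQ z : Zv z -> eproj 'i (jpart z) *m eproj 'i (jpart z) = eproj 'i (jpart z).
  by move=> /ZvarP[j3 _ _]; rewrite eprojM ?roots3_i // eqxx.
apply: local_frame Z0 => [|z Zz|z Zz].
- apply: polymx_block; try exact: polymx_cst.
  apply: polymx_block; try exact: polymx_cst.
    apply: polymxD; first exact: polymx_cst.
    by apply: polymxN; exact: polymx_eproj.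
  apply: polymxD; first exact: polymx_cst.
  apply: polymxN => i j; apply: (@polyfun_ext _ _ (fun z => \sum_(c <- roots3 C)
    lin_mx (mulmxr (eproj c (jpart z)) \o mulmx (eproj c (jpart z))) i j)).
    by move=> z; rewrite /diagmx summxE.
  apply: polyfun_sum => c; apply: polymx_lin => W.
  have pe := @polymx_eproj R a e c.
  by apply: polymxM => //; apply: polymxM => //; exact: polymx_cst.
- have [j3 _ _] := (ZvarP n z).1 Zz.
  by apply: tanproj_idem => //; exact: QQ.
- have [_ t _] := mxtrace_Zvar Zz.
  by apply: mxrank_tanproj => //; exact: QQ.
Qed.

Definition conjpt (z : 'rV[C]_m) : 'rV[C]_m := map_mx Num.conj z.

(** The equations have integer coefficients, so conjugation preserves their solutions. *)
Lemma real_structure_Zvar : real_structure Zv conjpt.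
Proof.
split.
- exists (fun k => mpoly.mpolyX _ (mpoly.mnm1 k)) => z _; apply/rowP => k.
  by rewrite !mxE /evalp mpoly.mevalXU.
- move=> z /ZvarP[j3 t1 t2]; apply/ZvarP.
  have -> : jpart (conjpt z) = map_mx Num.conj (jpart z).
    by apply/matrixP => i j; rewrite !mxE.
  split.
  + by rewrite /cubic -!map_mxM -map_mxD (_ : _ + _ = 0) ?map_mx0.
  + by rewrite trace_map_mx t1 rmorph0.
  + by rewrite -map_mxM trace_map_mx t2 rmorphN rmorph_nat.
- by move=> z _; apply/rowP => k; rewrite !mxE conjCK.
Qed.

End VarietyGeometry.

(** Naming the entry map lets it carry a linear structure, so that [diff_lin] computes its
    differential. *)
Definition mxcoord (R : realType) (p q : nat) (i : 'I_p) (j : 'I_q)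
  (M : 'M[R]_(p, q)) : R := M i j.

Lemma mxcoord_linear (R : realType) (p q : nat) (i : 'I_p) (j : 'I_q) :
  linear (@mxcoord R p q i j).
Proof. by move=> c A B; rewrite /mxcoord !mxE. Qed.

HB.instance Definition _ (R : realType) (p q : nat) (i : 'I_p) (j : 'I_q) :=
  GRing.isLinear.Build R 'M[R]_(p, q) R _ (@mxcoord R p q i j)
    (mxcoord_linear i j).

(** * Calculus of C^k functions *)

Lemma open_near (T : topologicalType) (A : set T) (P : T -> Prop) :
  open A -> (forall x, A x -> P x) ->
  forall x, A x -> \near x, P x.
Proof.
by move=> oA AP x Ax; apply: filterS AP _; apply: open_nbhs_nbhs; split.
Qed.

Section DiffFacts.
Variables (R : realType) (V : normedModType R).

Lemma near_eq_diff (W : normedModType R) (f g : V -> W) (x : V) :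
  (\near x, f x = g x) -> differentiable f x ->
  differentiable g x /\ 'd g x = 'd f x :> (V -> W).
Proof.
move=> fg df; have fgx : f x = g x := nbhs_singleton fg.
have cf := diff_continuous df.
have e : g \o shift x = cst (g x) + 'd f x +o_ 0 id.
  apply/eqaddoP => eps eps0.
  have /eqaddoP/(_ eps eps0) h := diff_locally df.
  have fg' : \forall y \near 0, f (y + x) = g (y + x).
    by move: fg; rewrite (near_shift 0 x) /= subr0.
  by near=> y; rewrite !fctE /= -fgx -(near fg' y) //; near: y; exact: h.
have dg : 'd g x = 'd f x :> (V -> W) by exact: diff_unique.
by split; first (apply/diff_locallyP; rewrite dg; split).
Unshelve. all: by end_near. Qed.

Lemma diff_compE (W1 W2 : normedModType R) (f : V -> W1) (g : W1 -> W2) x y v :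
  differentiable f x -> differentiable g y -> f x = y ->
  'd (g \o f) x v = 'd g y ('d f x v).
Proof. by move=> df + e; rewrite -e => dg; rewrite (diff_comp df dg). Qed.

Lemma diff_mxE p q (f : V -> 'M[R]_(p, q)) x v i j : differentiable f x ->
  differentiable (fun y => f y i j) x /\
  'd (fun y => f y i j) x v = 'd f x v i j.
Proof.
move=> df; have cc : continuous (@mxcoord R p q i j) := @coord_continuous R p q i j.
have dc : differentiable (@mxcoord R p q i j) (f x) by exact: linear_differentiable.
split; first exact: (differentiable_comp df dc).
by rewrite (diff_comp df dc) /= diff_lin.
Qed.

Lemma differentiable_mx p q (f : V -> 'M[R]_(p, q)) x :
  (forall i j, differentiable (fun y => f y i j) x) -> differentiable f x.
Proof.
move=> df.
have -> : f = \sum_i \sum_j (fun y => f y i j *: delta_mx i j).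
  apply/funext => y; rewrite fct_sumE {1}[f y]matrix_sum_delta.
  by apply: eq_bigr => i _; rewrite fct_sumE.
apply: differentiable_sum => i; apply: differentiable_sum => j.
exact: differentiableZl.
Qed.

End DiffFacts.

Section CkCalculus.
Variables (R : realType) (V : normedModType R).
Implicit Types (W : normedModType R) (A B : set V).

(** The rules below compute differentials by formulas valid on [A] only; this lemma turns such a
    formula into regularity. Openness of [A] makes the germs agree. *)
Lemma Ck_on_eq W k A (f g : V -> W) : open A -> (forall x, A x -> f x = g x) ->
  Ck_on k A f -> Ck_on k A g.
Proof.
move=> oA; elim: k f g => [|k IH] f g fg.
  move=> cf x Ax; have := cf x Ax; rewrite /prop_for /continuous_at (fg x Ax).
  by apply: cvg_trans; apply: near_eq_cvg; exact: open_near Ax.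
have fgn := open_near oA fg.
move=> [df Cf]; split=> [x Ax|v]; first by have [] := near_eq_diff (fgn x Ax) (df x Ax).
apply: IH (Cf v) => x Ax.
by have [_ ->] := near_eq_diff (fgn x Ax) (df x Ax).
Qed.

Lemma Ck_on_sub W k A B (f : V -> W) : A `<=` B -> Ck_on k B f -> Ck_on k A f.
Proof.
move=> AB; elim: k f => [|k IH] f; first by move=> cf x /AB Bx; exact: (cf x Bx).
by move=> [df Cf]; split=> [x /AB Bx|v]; [exact: (df x Bx)|exact: IH (Cf v)].
Qed.

Lemma Ck_on_local W k A (f : V -> W) :
  (forall x, A x -> exists2 B, B x & Ck_on k B f) -> Ck_on k A f.
Proof.
elim: k f => [|k IH] f loc.
  by move=> x /loc[B Bx Cf]; exact: (Cf x Bx).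
split=> [x /loc[B Bx [df _]]|v]; first exact: (df x Bx).
by apply: IH => x /loc[B Bx [_ Cf]]; exists B; last exact: Cf.
Qed.

Lemma Ck_onW W k A (f : V -> W) : Ck_on k.+1 A f -> Ck_on k A f.
Proof.
elim: k f => [|k IH] f [df Cf].
  by move=> x Ax; exact: differentiable_continuous (df x Ax).
by split=> // v; exact: IH.
Qed.

Lemma smooth_on_differentiable W A (f : V -> W) x :
  smooth_on A f -> A x -> differentiable f x.
Proof. by move=> /(_ 1)[df _]; exact: df. Qed.

Lemma smooth_on_diff W A (f : V -> W) v :
  smooth_on A f -> smooth_on A (fun x => 'd f x v).
Proof. by move=> Sf k; have [_ Cf] := Sf k.+1; exact: Cf. Qed.

Lemma Ck_on_cst W k A (c : W) : open A -> Ck_on k A (fun=> c).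
Proof.
move=> oA; elim: k c => [|k IH] c; first by move=> x _; exact: cvg_cst.
split=> [x _|v]; first exact: differentiable_cst.
by apply: Ck_on_eq (IH 0) => // x _; rewrite diff_cst.
Qed.

Lemma Ck_on_lin W k A (L : {linear V -> W}) : open A -> continuous L ->
  Ck_on k A L.
Proof.
move=> oA cL; case: k => [|k]; first by move=> x _; exact: cL.
split=> [x _|v]; first exact: linear_differentiable.
by apply: Ck_on_eq (Ck_on_cst k (L v) oA) => // x _; rewrite diff_lin.
Qed.

Lemma Ck_onD W k A (f g : V -> W) : open A ->
  Ck_on k A f -> Ck_on k A g -> Ck_on k A (fun x => f x + g x).
Proof.
move=> oA; elim: k f g => [|k IH] f g.
  by move=> cf cg x Ax; apply: continuousD; [exact: cf|exact: cg].
move=> [df Cf] [dg Cg]; split=> [x Ax|v].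
  exact: (differentiableD (df x Ax) (dg x Ax)).
apply: Ck_on_eq (IH _ _ (Cf v) (Cg v)) => // x Ax.
exact: (esym (congr1 (fun h => h v) (diffD (df x Ax) (dg x Ax)))).
Qed.

Lemma Ck_on_sum W k A I (r : seq I) (f : I -> V -> W) : open A ->
  (forall i, Ck_on k A (f i)) -> Ck_on k A (fun x => \sum_(i <- r) f i x).
Proof.
move=> oA Cf; elim: r => [|i r IH].
  by apply: Ck_on_eq (Ck_on_cst k 0 oA) => // x _; rewrite big_nil.
by apply: Ck_on_eq (Ck_onD oA (Cf i) IH) => // x _; rewrite big_cons.
Qed.

Lemma Ck_onM k A (f g : V -> R) : open A ->
  Ck_on k A f -> Ck_on k A g -> Ck_on k A (fun x => f x * g x).
Proof.
move=> oA; elim: k f g => [|k IH] f g.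
  by move=> cf cg x Ax; apply: continuousM; [exact: cf|exact: cg].
move=> Cf1 Cg1; have [df Cf] := Cf1; have [dg Cg] := Cg1; split=> [x Ax|v].
  exact: (differentiableM (df x Ax) (dg x Ax)).
have := Ck_onD oA (IH _ _ (Ck_onW Cf1) (Cg v)) (IH _ _ (Ck_onW Cg1) (Cf v)).
apply: Ck_on_eq => // x Ax.
exact: (esym (congr1 (fun h => h v) (diffM (df x Ax) (dg x Ax)))).
Qed.

Lemma Ck_onZl W k A (f : V -> R) (w : W) : open A ->
  Ck_on k A f -> Ck_on k A (fun x => f x *: w).
Proof.
move=> oA; elim: k f => [|k IH] f.
  by move=> cf x Ax; apply: continuousZr_tmp; exact: cf.
move=> [df Cf]; split=> [x Ax|v]; first exact: differentiableZl (df x Ax).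
apply: Ck_on_eq (IH _ (Cf v)) => // x Ax.
exact: (esym (congr1 (fun h => h v) (diffZl w (df x Ax)))).
Qed.

Lemma Ck_onV k A (f : V -> R) : open A -> (forall x, A x -> f x != 0) ->
  Ck_on k A f -> Ck_on k A (fun x => (f x)^-1).
Proof.
move=> oA f0; elim: k => [|k IH].
  by move=> cf x Ax; apply: continuousV; [exact: f0|exact: cf].
move=> Cf1; have [df Cf] := Cf1; split=> [x Ax|v].
  exact: (differentiableV (df x Ax) (f0 x Ax)).
have Ci := IH (Ck_onW Cf1).
have := Ck_onM oA (Ck_onM oA (Ck_on_cst k (-1 : R) oA) (Ck_onM oA Ci Ci)) (Cf v).
apply: Ck_on_eq => // x Ax.
rewrite [RHS](congr1 (fun h => h v) (diffV (df x Ax) (f0 x Ax))) /=.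
by rewrite mulN1r -expr2 exprVn.
Qed.

Lemma Ck_on_mx k A p q (f : V -> 'M[R]_(p, q)) : open A ->
  (forall i j, Ck_on k A (fun x => f x i j)) -> Ck_on k A f.
Proof.
move=> oA Cf.
have : Ck_on k A (fun x => \sum_i \sum_j f x i j *: (delta_mx i j : 'M[R]_(p, q))).
  by apply: Ck_on_sum => // i; apply: Ck_on_sum => // j; exact: Ck_onZl.
by apply: Ck_on_eq => // x _; rewrite -matrix_sum_delta.
Qed.

Lemma Ck_on_mxE k A p q (f : V -> 'M[R]_(p, q)) i j : open A ->
  Ck_on k A f -> Ck_on k A (fun x => f x i j).
Proof.
move=> oA; elim: k f => [|k IH] f.
  move=> cf x Ax; apply: (continuous_comp (g := fun M : 'M[R]_(p, q) => M i j)).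
    exact: cf.
  exact: coord_continuous.
move=> [df Cf]; split=> [x Ax|v]; first by have [] := diff_mxE 0 i j (df x Ax).
apply: Ck_on_eq (IH _ (Cf v)) => // x Ax.
by have [_ ->] := diff_mxE v i j (df x Ax).
Qed.

End CkCalculus.

Section CkComposition.
Variables (R : realType) (V : normedModType R).
Implicit Types (W : normedModType R) (A B : set V).

(** In the chain rule, [f] is differentiated in a direction that moves with [x], whereas [Ck_on]
    speaks of fixed directions. Expanding the moving direction in the standard basis reduces to
    fixed ones, to which the induction applies. *)
Lemma Ck_on_comp_fun k d A (B : set 'rV[R]_d) (t : V -> 'rV[R]_d)
    (f : 'rV[R]_d -> R) : open A -> (forall x, A x -> B (t x)) ->
  smooth_on A t -> Ck_on k B f -> Ck_on k A (f \o t).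
Proof.
move=> oA AB St; elim: k f => [|k IH] f.
  move=> cf x Ax; apply: continuous_comp (cf _ (AB x Ax)).
  exact: (St 0 x Ax).
have dt x (Ax : A x) : differentiable t x := smooth_on_differentiable St Ax.
move=> [df Cf]; split=> [x Ax|v].
  exact: (differentiable_comp (dt x Ax) (df _ (AB x Ax))).
have : Ck_on k A (fun x => \sum_i 'd t x v 0 i * 'd f (t x) (delta_mx 0 i)).
  apply: Ck_on_sum => // i; apply: Ck_onM => //; last exact: IH (Cf _).
  by apply: Ck_on_mxE => //; exact: smooth_on_diff.
apply: Ck_on_eq => // x Ax; rewrite (diff_comp (dt x Ax) (df _ (AB x Ax))) /=.
rewrite {2}(row_sum_delta ('d t x v)) linear_sum.
by apply: eq_bigr => i _; rewrite linearZ.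
Qed.

Lemma Ck_on_comp k d p q A (B : set 'rV[R]_d) (t : V -> 'rV[R]_d)
    (f : 'rV[R]_d -> 'M[R]_(p, q)) : open A -> open B ->
  (forall x, A x -> B (t x)) ->
  smooth_on A t -> Ck_on k B f -> Ck_on k A (f \o t).
Proof.
move=> oA oB AB St Cf; apply: Ck_on_mx => // i j.
have Cij := Ck_on_mxE i j oB Cf.
exact: (Ck_on_comp_fun (f := fun y => f y i j) oA AB St Cij).
Qed.

Lemma Ck_on_comp1 k A (t : V -> R) (f : R -> R) : open A ->
  smooth_on A t -> Ck_on k setT f -> Ck_on k A (f \o t).
Proof.
move=> oA St; elim: k f => [|k IH] f.
  by move=> cf x Ax; apply: continuous_comp (cf _ _) => //; exact: (St 0 x Ax).
have dt x (Ax : A x) : differentiable t x := smooth_on_differentiable St Ax.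
move=> [df Cf]; split=> [x Ax|v].
  exact: (differentiable_comp (dt x Ax) (df (t x) I)).
have : Ck_on k A (fun x => 'd t x v * 'd f (t x) 1).
  by apply: Ck_onM => //; [exact: smooth_on_diff|exact: IH (Cf _)].
apply: Ck_on_eq => // x Ax.
rewrite [RHS](congr1 (fun h => h v) (diff_comp (dt x Ax) (df (t x) I))).
by rewrite [RHS]/= -[X in _ = 'd f _ X]mulr1 linearZ.
Qed.

Lemma Ck_on_prod k A I (r : seq I) (f : I -> V -> R) : open A ->
  (forall i, Ck_on k A (f i)) -> Ck_on k A (fun x => \prod_(i <- r) f i x).
Proof.
move=> oA Cf; elim: r => [|i r IH].
  by apply: Ck_on_eq (Ck_on_cst k (1 : R) oA) => // x _; rewrite big_nil.
by apply: Ck_on_eq (Ck_onM oA (Cf i) IH) => // x _; rewrite big_cons.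
Qed.

Lemma Ck_on_mulmx k A p q r (f : V -> 'M[R]_(p, q)) (g : V -> 'M[R]_(q, r)) :
  open A -> Ck_on k A f -> Ck_on k A g -> Ck_on k A (fun x => f x *m g x).
Proof.
move=> oA Cf Cg; apply: Ck_on_mx => // i j.
have : Ck_on k A (fun x => \sum_l f x i l * g x l j).
  by apply: Ck_on_sum => // l; apply: Ck_onM => //; exact: Ck_on_mxE.
by apply: Ck_on_eq => // x _; rewrite mxE.
Qed.

Lemma Ck_on_mxsub k A p q p' q' (f : V -> 'M[R]_(p, q)) (g : V -> 'M[R]_(p', q'))
    (s : 'I_p' -> 'I_q' -> 'I_p * 'I_q) : open A ->
  (forall x i j, g x i j = f x (s i j).1 (s i j).2) ->
  Ck_on k A f -> Ck_on k A g.
Proof.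
move=> oA gf Cf; apply: Ck_on_mx => // i j.
by apply: Ck_on_eq (Ck_on_mxE (s i j).1 (s i j).2 oA Cf) => // x _; rewrite gf.
Qed.

Lemma Ck_on_det k A p (f : V -> 'M[R]_p) : open A ->
  Ck_on k A f -> Ck_on k A (fun x => \det (f x)).
Proof.
move=> oA Cf; apply: Ck_on_sum => // s; apply: Ck_onM => //.
  exact: Ck_on_cst.
by apply: Ck_on_prod => // i; exact: Ck_on_mxE.
Qed.

Lemma Ck_on_invmx k A p (f : V -> 'M[R]_p) : open A ->
  (forall x, A x -> f x \in unitmx) ->
  Ck_on k A f -> Ck_on k A (fun x => invmx (f x)).
Proof.
move=> oA fu Cf; apply: Ck_on_mx => // i j.
have : Ck_on k A (fun x => (\det (f x))^-1 * cofactor (f x) j i).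
  apply: Ck_onM => //; first apply: Ck_onV => //; last apply: Ck_onM => //.
  - by move=> x Ax; rewrite -unitfE -unitmxE fu.
  - exact: Ck_on_det.
  - exact: Ck_on_cst.
  apply: Ck_on_det => //.
  apply: (Ck_on_mxsub (s := fun k l => (lift j k, lift i l)) oA _ Cf) => x u v.
  by rewrite !mxE.
by apply: Ck_on_eq => // x Ax; rewrite /invmx fu // !mxE.
Qed.

Lemma Ck_on_row_mx k A p q1 q2 (f : V -> 'M[R]_(p, q1)) (g : V -> 'M[R]_(p, q2)) :
  open A -> Ck_on k A f -> Ck_on k A g -> Ck_on k A (fun x => row_mx (f x) (g x)).
Proof.
move=> oA Cf Cg; apply: Ck_on_mx => // i j; case: (split_ordP j) => l ->.
  by apply: Ck_on_eq (Ck_on_mxE i l oA Cf) => // x _; rewrite row_mxEl.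
by apply: Ck_on_eq (Ck_on_mxE i l oA Cg) => // x _; rewrite row_mxEr.
Qed.

Lemma Ck_on_mxvec k A p q (f : V -> 'M[R]_(p, q)) :
  open A -> Ck_on k A f -> Ck_on k A (fun x => mxvec (f x)).
Proof.
move=> oA Cf; apply: Ck_on_mx => // i j; rewrite (ord1 i).
case/mxvec_indexP: j => u v.
by apply: Ck_on_eq (Ck_on_mxE u v oA Cf) => // x _; rewrite mxvecE.
Qed.

End CkComposition.

Lemma smooth_on_id (R : realType) (V : normedModType R) (A : set V) :
  open A -> smooth_on A (fun x : V => x).
Proof.
by move=> oA k; apply: (Ck_on_lin k (L := idfun) oA) => x; exact: cvg_id.
Qed.

(** * The Whitney embedding theorem *)

Section FlatFunction.
Variable R : realType.
Implicit Types (m k : nat) (x : R).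

(** The factor [x^-m] makes the family stable: the derivative of each member is a linear combination
    of the next two, so smoothness is an induction on the order. *)
Definition flat m x : R := if 0 < x then x ^- m * expR (- x^-1) else 0.

Lemma flat_gt0 m x : 0 < x -> 0 < flat m x.
Proof. by move=> x0; rewrite /flat x0 mulr_gt0 ?expR_gt0 // invr_gt0 exprn_gt0. Qed.

Lemma flat_le0 m x : x <= 0 -> flat m x = 0.
Proof. by move=> x0; rewrite /flat ltNge x0. Qed.

(** Comes from [expR y >= y^(m+2) / (m+2)!] at [y = x^-1]. The quadratic bound makes the difference
    quotient at 0 tend to 0. *)
Lemma flat_bound m x : `|flat m x| <= (m.+2)`!%:R * x ^+ 2.
Proof.
have [x0|x0] := ltP 0 x; last by rewrite flat_le0 // normr0 mulr_ge0 ?sqr_ge0.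
rewrite ger0_norm ?(ltW (flat_gt0 _ _)) // /flat x0 expRN.
have xm : 0 < x ^+ m by exact: exprn_gt0.
rewrite -invfM invf_ple ?qualifE/= ?mulr_gt0 ?expR_gt0 ?ltr0n ?fact_gt0 ?exprn_gt0 //.
have xv0 : 0 <= x^-1 by rewrite invr_ge0 ltW.
apply: (@le_trans _ _ (x ^+ m * (x^-1 ^+ m.+2 / (m.+2)`!%:R))).
  rewrite exprVn -[in leRHS]addn2 exprD !invfM -!mulrA mulVKf ?gt_eqF //.
  by rewrite addn2 [leRHS]mulrA [leRHS]mulrC.
rewrite ler_pM2l //; apply: le_trans (expR_ge1Dxn m.+1 xv0).
by rewrite lerDr.
Qed.

Lemma is_derive_flat m x :
  is_derive x (1 : R) (flat m) (flat m.+2 x - m%:R * flat m.+1 x).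
Proof.
have [x0|x0|x0] := ltgtP 0 x.
- have xn0 : x != 0 by rewrite gt_eqF.
  have dinv : is_derive x (1 : R) (fun y : R => y^-1) (- x ^- 2).
    have did : derivable (@id R) x 1 by exact: derivable_id.
    apply: DeriveDef; first exact: (derivableV xn0 did).
    by rewrite (deriveV xn0 did) derive_id [_ *: _]mulr1.
  have dE : is_derive x (1 : R) (fun y => expR (- y^-1)) (x ^- 2 * expR (- x^-1)).
    have dNinv : is_derive x (1 : R) (fun y : R => - y^-1) (x ^- 2).
      by have := is_deriveN dinv; rewrite opprK.
    have dexp := is_derive_expR (- x^-1).
    apply: DeriveDef.
      apply/derivable1_diffP.
      apply: (differentiable_comp (f := fun y : R => - y^-1) (g := expR)).
        by apply/derivable1_diffP; exact: ex_derive.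
      by apply/derivable1_diffP; exact: ex_derive.
    rewrite -derive1E (derive1_comp (f := fun y : R => - y^-1) (g := expR)) //.
    by rewrite !derive1E !derive_val mulrC.
  have := is_deriveM (is_deriveX m dinv) dE.
  set D := (X in is_derive _ _ _ X) => dP.
  have -> : flat m.+2 x - m%:R * flat m.+1 x = D.
    rewrite /D /flat x0 !fctE -!exprVn.
    move: x^-1 (expR _) => w E.
    have sE (u v : R) : u *: (v : R^o) = u * v by [].
    rewrite !sE; case: (m) => [|k] /=; first by ring.
    by rewrite !exprS; ring.
  apply: near_eq_is_derive dP.
  have : \forall y \near x, 0 < y by exact: lt_nbhsr.
  by apply: filterS => y y0; rewrite /flat y0 !fctE exprVn.
- rewrite !flat_le0 ?(ltW x0) // mulr0 subr0.
  apply: near_eq_is_derive (is_derive_cst 0 x 1).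
  have : \forall y \near x, y < 0 by exact: lt_nbhsl.
  by apply: filterS => y y0; rewrite flat_le0 ?ltW.
- rewrite -x0 !flat_le0 // mulr0 subr0.
  have cv : (fun h => h^-1 *: ((flat m \o shift 0) (h *: 1) - flat m 0)) @ 0^' --> (0 : R).
    apply/cvgrPdist_le => eps eps0.
    set C : R := (m.+2)`!%:R.
    have C0 : 0 < C by rewrite ltr0n fact_gt0.
    near=> h.
    have h0 : h != 0 by near: h; exact: nbhs_dnbhs_neq.
    rewrite sub0r normrN /= addr0 [h *: 1]mulr1 [flat m 0]flat_le0 // subr0 normrZ normfV.
    rewrite ler_pdivrMl ?normr_gt0 //; apply: le_trans (flat_bound m h) _.
    have -> : h ^+ 2 = `|h| * `|h| by rewrite -normrM -expr2 ger0_norm ?sqr_ge0.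
    rewrite mulrCA ler_pM2l ?normr_gt0 // -ler_pdivlMl //.
    near: h; apply: dnbhs0_le; by rewrite mulr_gt0 // invr_gt0.
  by apply: DeriveDef; [apply/cvg_ex; exists 0|exact: cvg_lim cv].
Unshelve. all: by end_near. Qed.

Lemma smooth_flat m : smooth_on setT (flat m).
Proof.
move=> k; elim: k m => [|k IH] m.
  move=> x _; apply: differentiable_continuous; apply/derivable1_diffP.
  by have [] := is_derive_flat m x.
have df x : differentiable (flat m) x.
  by apply/derivable1_diffP; have [] := is_derive_flat m x.
split=> [x _|v]; first exact: df.
have : Ck_on k setT (fun x => v * (flat m.+2 x + - m%:R * flat m.+1 x)).
  apply: (Ck_onM openT (Ck_on_cst k v openT)).
  exact: (Ck_onD openT (IH _) (Ck_onM openT (Ck_on_cst k (- m%:R : R) openT) (IH _))).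
apply: (Ck_on_eq openT) => x _.
rewrite (congr1 (fun h => h v) (diff1E (df x))) derive1E.
by have [_ ->] := is_derive_flat m x; rewrite mulNr.
Qed.

End FlatFunction.

(** * Meager images of maps into a space of larger dimension *)

Section Meager.
Variable R : realType.

Lemma norm_rV_le p (x : 'rV[R]_p) (e : R) : 0 <= e ->
  (forall i, `|x 0 i| <= e) -> `|x| <= e.
Proof.
move=> e0 xe; rewrite [leLHS]/Num.Def.normr/= mx_normrE.
by apply: bigmax_le => // -[i j] _; rewrite /= (ord1 i).
Qed.

Lemma norm_rV_ge p (x : 'rV[R]_p) i : `|x 0 i| <= `|x|.
Proof.
rewrite [leRHS]/Num.Def.normr/= mx_normrE.
exact: (@le_bigmax _ _ _ 0 (fun ij : 'I_1 * 'I_p => `|x ij.1 ij.2|) (0, i)).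
Qed.

Definition meager q (A : set 'rV[R]_q) := exists F : nat -> set 'rV[R]_q,
  (forall i, open (F i) /\ dense (F i)) /\ A `<=` \bigcup_i ~` F i.

Lemma meager_sub q (A B : set 'rV[R]_q) : A `<=` B -> meager B -> meager A.
Proof. by move=> AB [F [oF BF]]; exists F; split=> //; exact: subset_trans BF. Qed.

Lemma meager_bigcup q (I : countType) (A : I -> set 'rV[R]_q) :
  (forall k, meager (A k)) -> meager (\bigcup_k A k).
Proof.
move=> /choice[F hF].
(* Pairs [(k, i)] are enumerated through [unpickle]; an integer that codes no pair contributes the
   whole space, whose complement is empty. *)
exists (fun n => if unpickle n is Some ki then F ki.1 ki.2 else setT).
split=> [n|x [k _ Akx]].
  case: unpickle => [[k i]|] /=; first by have [/(_ i)] := hF k.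
  by split; [exact: openT|move=> O O0 _; rewrite setIT].
have [_ /(_ x Akx)[i _ xi]] := hF k.
by exists (pickle (k, i)) => //=; rewrite pickleK.
Qed.

Lemma meager_compl q (A : set 'rV[R]_q) : meager A -> exists u, ~ A u.
Proof.
move=> [F [oF AF]].
pose U : completeNormedModType R := HB.pack 'rV[R]_q.
have : dense (\bigcap_i F i) := @Baire R U F oF.
move=> /(_ setT)[||u [_ Fu]]; [by exists 0|exact: openT|].
by exists u => /AF[i _]; apply; exact: Fu.
Qed.

(** Differentiability at each point, without continuity of the derivative, already cuts [S] into
    countably many such pieces; on each one the Lipschitz constant and the scale are uniform. *)
Definition lipset p q (S : set 'rV[R]_p) (g : 'rV[R]_p -> 'rV[R]_q) (m : nat) :=
  [set x | [/\ S x, `|x| <= m%:R &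
    forall y, S y -> `|x - y| <= m.+1%:R^-1 -> `|g x - g y| <= m%:R * `|x - y|]].

(* Pigeonhole on grids: a cube of dimension [q] contains [L ^ q] points at
   mutual distance of order [1 / L], whereas [O (L ^ p)] cells of size [1 / L]
   cover the source. *)
Lemma lipset_image_gap p q (S : set 'rV[R]_p) (g : 'rV[R]_p -> 'rV[R]_q) m
    (c : 'rV[R]_q) (r : R) : (p < q)%N -> 0 < r ->
  exists2 u : 'rV[R]_q, `|u - c| < r &
    exists2 e : R, 0 < e & forall x, lipset S g m x -> e <= `|g x - u|.
Proof.
move=> pq r0.
(* Cells have side [1 / (s L)]. The bound [s > m] puts two points of a cell within the scale
   [1 / (m + 1)], and [s > 8 m / r] makes the image of a cell smaller than [r / (8 L)]. *)
pose s : nat := maxn m.+1 (Num.trunc (8 * m%:R / r)).+1.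
have s_m : (m < s)%N by rewrite leq_max leqnn.
have s_r : 8 * m%:R / r < s%:R.
  have b0 : 0 <= 8 * m%:R / r by rewrite !mulr_ge0 ?invr_ge0 // ltW.
  have /andP[_ lt1] := truncn_itv b0; apply: lt_le_trans lt1 _.
  by rewrite ler_nat leq_max leqnn orbT.
pose K : nat := ((2 * m * s).+1)%N.
(* There are at most [(K L)^p] cells, and [L > K^p] gives [(K L)^p < L^(p+1) <= L^q]. *)
pose L : nat := (K ^ p).+1.
have L0 : 0 < L%:R :> R by rewrite ltr0n.
have card_lt : ((2 * m * (s * L)).+1 ^ p < L ^ q)%N.
  apply: (@leq_ltn_trans ((K * L) ^ p)).
    case: (posnP p) => [->//|p0]; rewrite leq_exp2r //.
    by rewrite /K; move: L0; rewrite ltr0n; move: L; lia.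
  rewrite expnMn; apply: (@leq_trans (L ^ p.+1)); last by rewrite leq_pexp2l.
  by rewrite expnS ltn_pmul2r ?expn_gt0.
pose pt (f : {ffun 'I_q -> 'I_L}) : 'rV[R]_q :=
  c + \row_i (r / 2 * (f i : nat)%:R / L%:R).
have pt_c f : `|pt f - c| < r.
  rewrite /pt addrAC subrr add0r.
  have r2 : 0 <= r / 2 by rewrite divr_ge0 // ltW.
  apply: (@le_lt_trans _ _ (r / 2)); last by rewrite ltr_pdivrMr // ltr_pMr // ltr1n.
  apply: norm_rV_le => // i; rewrite mxE.
  have nn : 0 <= r / 2 * (f i : nat)%:R / L%:R :> R.
    by apply: divr_ge0 => //; apply: mulr_ge0.
  rewrite (ger0_norm nn).
  by rewrite ler_pdivrMr // ler_wpM2l // ler_nat ltnW.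
have pt_sep f f' : f != f' -> r / (2 * L%:R) <= `|pt f - pt f'|.
  move=> ff'; have [i fi] : exists i, f i != f' i.
    apply/existsP; apply: contraNT ff' => /existsPn h.
    by apply/eqP/ffunP => i; have := h i; rewrite negbK => /eqP.
  apply: le_trans (norm_rV_ge _ i); rewrite /pt !mxE.
  rewrite opprD addrACA subrr add0r -mulrBl -mulrBr normrM normrM.
  rewrite (ger0_norm (divr_ge0 (ltW r0) _)) // [`|L%:R^-1|]ger0_norm ?invr_ge0 //.
  rewrite invfM mulrA ler_pM2r ?invr_gt0 // ler_peMr //.
    by rewrite divr_ge0 // ltW.
  wlog : f f' ff' fi / (f' i <= f i)%N => [hw|le].
    by have [|/ltnW] := leqP (f' i) (f i); [|rewrite distrC]; apply: hw; rewrite // eq_sym.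
  rewrite -natrB // normr_nat ler1n subn_gt0 ltn_neqAle le andbT.
  by apply: contra fi => /eqP e; apply/eqP/val_inj.
(* Otherwise every grid point is within [r / (8 L)] of the image. Two grid points whose preimages
   share a cell are then closer than [3 r / (8 L)], below the separation [r / (2 L)]; so the map to
   cells is injective, against the count. *)
apply: contrapT => no_gap.
have /choice[x hx] : forall f : {ffun 'I_q -> 'I_L}, exists x,
    lipset S g m x /\ `|g x - pt f| < r / (8 * L%:R).
  move=> f; apply: contrapT => nx; apply: no_gap; exists (pt f); first exact: pt_c.
  exists (r / (8 * L%:R)); first by rewrite divr_gt0 // mulr_gt0.
  by move=> x xl; rewrite leNgt; apply/negP => lt; apply: nx; exists x.
pose cell (f : {ffun 'I_q -> 'I_L}) : {ffun 'I_p -> 'I_((2 * m * (s * L)).+1)} :=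
  [ffun i => inord (Num.trunc ((x f 0 i + m%:R) * (s * L)%:R))].
have xm f i : 0 <= (x f 0 i + m%:R) * (s * L)%:R <= (2 * m * (s * L))%:R.
  have [[_ xfm _] _] := hx f.
  have : `|x f 0 i| <= m%:R := le_trans (norm_rV_ge _ _) xfm.
  rewrite ler_norml => /andP[l1 l2]; apply/andP; split.
    by apply: mulr_ge0 => //; lra.
  by rewrite (natrM _ (2 * m)%N) ler_wpM2r // natrM; lra.
have : injective cell.
  move=> f f' ecell; apply/eqP; apply: contraT => ff'.
  have [[Sx _ lipx] px] := hx f; have [[Sx' _ _] px'] := hx f'.
  have sL0 : 0 < (s * L)%:R :> R by rewrite ltr0n muln_gt0 (leq_trans _ s_m).
  have close : `|x f - x f'| <= (s * L)%:R^-1.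
    apply: norm_rV_le => [|i]; first by rewrite invr_ge0.
    have : nat_of_ord (cell f i) = nat_of_ord (cell f' i) by rewrite ecell.
    rewrite !ffunE.
    have inb h : (Num.trunc ((x h 0 i + m%:R) * (s * L)%:R)%R < (2 * m * (s * L)).+1)%N.
      have /andP[x0 x1] := xm h i; have /andP[t1 _] := truncn_itv x0.
      by rewrite ltnS -(ler_nat R) (le_trans t1).
    rewrite /= !inordK // => et.
    have /andP[x0 _] := xm f i; have /andP[x0' _] := xm f' i.
    have := truncn_itv x0; have := truncn_itv x0'; rewrite et.
    move=> /andP[a1 a2] /andP[b1 b2].
    rewrite !mxE -[_^-1]mul1r ler_pdivlMr // -{1}(ger0_norm (ltW sL0)) -normrM.
    rewrite -natr1 in a2 b2; rewrite ler_norml; apply/andP; split; lra.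
  have lip : `|g (x f) - g (x f')| <= m%:R / (s * L)%:R.
    have close2 : `|x f - x f'| <= m.+1%:R^-1.
      apply: le_trans close _; rewrite lef_pV2 ?posrE //.
      by rewrite ler_nat (leq_trans s_m) // leq_pmulr.
    by apply: le_trans (lipx _ Sx' close2) _; apply: ler_wpM2l.
  have far := pt_sep _ _ ff'.
  have : `|pt f - pt f'| <= r / (8 * L%:R) + m%:R / (s * L)%:R + r / (8 * L%:R).
    have -> : pt f - pt f' = (pt f - g (x f)) + (g (x f) - g (x f')) + (g (x f') - pt f').
      by rewrite !subrKA.
    apply: le_trans (ler_normD _ _) _; apply: lerD; last exact: ltW.
    apply: le_trans (ler_normD _ _) _; apply: lerD => //.
    by rewrite distrC ltW.
  move=> /(le_trans far); rewrite natrM !invfM !mulrA -!mulrDl ler_pM2r ?invr_gt0 //.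
  have s0 : 0 < s%:R :> R by rewrite ltr0n (leq_trans _ s_m).
  have : m%:R / s%:R < r / 8.
    rewrite ltr_pdivrMr // mulrAC ltr_pdivlMr //.
    by move: s_r; rewrite ltr_pdivrMr // [s%:R * r]mulrC [m%:R * 8]mulrC.
  by move=> ms; lra.
move/leq_card; rewrite !card_ffun !card_ord => /(leq_trans card_lt).
by rewrite ltnn.
Qed.

(** The gap found near every point makes the image nowhere dense, so the complement of its closure
    serves as a constant sequence of dense open sets. *)
Lemma meager_lipset p q (S : set 'rV[R]_p) (g : 'rV[R]_p -> 'rV[R]_q) m :
  (p < q)%N -> meager (g @` lipset S g m).
Proof.
move=> pq; set A := g @` _; exists (fun _ => ~` closure A); split=> [_|x Ax].
  split; first by apply: closed_openC; exact: closed_closure.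
  move=> O [c Oc] oO.
  have /nbhs_ballP[r /= r0 cO] : nbhs c O by exact: open_nbhs_nbhs.
  have [u uc [e e0 gap]] := lipset_image_gap S g m c pq r0.
  exists u; split; first by apply: cO; rewrite -ball_normE /= distrC.
  move=> /(_ (ball u e) (nbhsx_ballx u e e0))[_ [[x lx <-]]].
  by rewrite -ball_normE /= distrC ltNge gap.
by exists 0%N => //; apply; exact: subset_closure.
Qed.

Lemma differentiable_lip p q (g : 'rV[R]_p -> 'rV[R]_q) x : differentiable g x ->
  exists m : nat, forall y, `|x - y| <= m.+1%:R^-1 ->
    `|g x - g y| <= m%:R * `|x - y|.
Proof.
move=> dg; have [k k0 kl] := linear_lipschitz (diff_continuous dg).
have /eqaddoP/(_ 1 ltr01)/nbhs_ballP[d /= d0 hd] := diff_locally dg.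
(* Here [k] bounds the differential, the extra 1 absorbs the remainder, and [d] is the radius on
   which the remainder is controlled. *)
pose m := maxn (Num.trunc (k + 1)).+1 (Num.trunc d^-1).+1; exists m => y xy.
have mk : k + 1 <= m%:R.
  have /andP[_ /ltW lt] := truncn_itv (addr_ge0 (ltW k0) ler01).
  by apply: le_trans lt _; rewrite ler_nat leq_maxl.
have md : m.+1%:R^-1 < d.
  rewrite invf_plt ?posrE ?ltr0n //.
  have di : 0 <= d^-1 by rewrite invr_ge0 ltW.
  have /andP[_ lt] := truncn_itv di.
  by apply: lt_le_trans lt _; rewrite ler_nat ltnW // ltnS leq_maxr.
have := hd (y - x); rewrite -ball_normE /= sub0r normrN distrC.
move=> /(_ (le_lt_trans xy md)); rewrite !fctE /= subrK mul1r => h.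
rewrite distrC (_ : g y - g x = (g y - (g x + 'd g x (y - x))) + 'd g x (y - x)).
  apply: le_trans (ler_normD _ _) _; apply: (@le_trans _ _ (`|y - x| + k * `|y - x|)).
    by apply: lerD; [rewrite [leRHS]distrC|exact: kl].
  by rewrite -{1}[`|y - x|]mul1r -mulrDl addrC [`|y - x|]distrC ler_wpM2r.
by rewrite opprD addrA subrK.
Qed.

Lemma meager_image p q (S : set 'rV[R]_p) (g : 'rV[R]_p -> 'rV[R]_q) :
  (p < q)%N -> (forall x, S x -> differentiable g x) -> meager (g @` S).
Proof.
move=> pq dg.
apply: meager_sub (meager_bigcup (fun m => @meager_lipset p q S g m pq)).
move=> _ [x Sx <-]; have [m1 hm1] := differentiable_lip (dg x Sx).
pose m := maxn m1 (Num.trunc `|x|).+1.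
exists m => //; exists x => //; split=> // [|y Sy xy].
  have /andP[_ /ltW lt] := truncn_itv (normr_ge0 x).
  by apply: le_trans lt _; rewrite ler_nat leq_maxr.
apply: le_trans (hm1 y _) _.
  by apply: le_trans xy _; rewrite lef_pV2 ?posrE // ler_nat ltnS leq_maxl.
by rewrite ler_wpM2r // ler_nat leq_maxl.
Qed.

End Meager.

(** * Smooth maps and immersions on a manifold *)

Section ManifoldMaps.
Variables (R : realType) (d : nat) (X : smooth_manifold R d).
Local Notation ch := (chart X).
Local Notation ci := (chart_inv X).
Local Notation U i := (ch i @` dom X i).

Lemma dom_chart_inv i y : U i y -> dom X i (ci i y) /\ ch i (ci i y) = y.
Proof. by move=> [x xi <-]; rewrite chartK. Qed.

Lemma in_chart i x : dom X i x -> U i (ch i x).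
Proof. by move=> xi; exists x. Qed.

Lemma open_chart_inv_preimage i (O : set X) : open O ->
  open [set y | U i y /\ O (ci i y)].
Proof.
move=> oO; have oU := @chart_open R d X i.
have := @chart_inv_continuous R d X i; rewrite continuous_open_subspace // => c.
rewrite openE => y [Uy Oy]; apply: filterI; first exact: open_nbhs_nbhs.
by apply: (c y); rewrite ?inE //; exact: open_nbhs_nbhs.
Qed.

Lemma open_chart_preimage i (O : set 'rV[R]_d) : open O ->
  open [set x | dom X i x /\ O (ch i x)].
Proof.
move=> oO; have oU := @dom_open R d X i.
have := @chart_continuous R d X i; rewrite continuous_open_subspace // => c.
rewrite openE => y [Uy Oy]; apply: filterI; first exact: open_nbhs_nbhs.
by apply: (c y); rewrite ?inE //; exact: open_nbhs_nbhs.
Qed.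

Lemma open_overlap i j : open (ch i @` (dom X i `&` dom X j)).
Proof.
have -> : ch i @` (dom X i `&` dom X j) = [set y | U i y /\ dom X j (ci i y)].
  apply/seteqP; split=> [y [x [xi xj] <-]|y [Uy yj]].
    by rewrite /= chartK //; split => //; exists x.
  by exists (ci i y); [split => //|]; have [] := dom_chart_inv Uy.
by apply: open_chart_inv_preimage; exact: dom_open.
Qed.

Definition smooth_map q (f : X -> 'rV[R]_q) :=
  forall i, smooth_on (U i) (f \o ci i).

Definition immersive q (f : X -> 'rV[R]_q) := forall i x v, dom X i x ->
  'd (f \o ci i) (ch i x) v = 0 -> v = 0.

Definition embedding q (f : X -> 'rV[R]_q) :=
  [/\ smooth_map f, injective f & immersive f].

Lemma transition_diff i j x : dom X i x -> dom X j x ->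
  differentiable (ch j \o ci i) (ch i x).
Proof.
move=> xi xj; apply: (smooth_on_differentiable (@transition_smooth R d X i j)).
by exists x.
Qed.

Lemma transition_diffK i j x v : dom X i x -> dom X j x ->
  'd (ch i \o ci j) (ch j x) ('d (ch j \o ci i) (ch i x) v) = v.
Proof.
move=> xi xj; have dij := transition_diff xi xj; have dji := transition_diff xj xi.
have e : (ch j \o ci i) (ch i x) = ch j x by rewrite /= chartK.
apply: etrans (esym (diff_compE v dij dji e)) _.
have idn : \forall y \near ch i x, y = ((ch i \o ci j) \o (ch j \o ci i)) y.
  apply: (open_near (A := ch i @` (dom X i `&` dom X j))).
  - exact: open_overlap.
  - by move=> _ [y [yi yj] <-] /=; rewrite chartK //= chartK.
  - by exists x.
have did : differentiable (@id 'rV[R]_d) (ch i x) by exact: ex_diff.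
have [_ e'] := near_eq_diff idn did.
by apply: etrans (congr1 (fun h => h v) e') _; rewrite diff_val.
Qed.

Lemma diff_change_chart q (f : X -> 'rV[R]_q) i j x v : smooth_map f ->
  dom X i x -> dom X j x ->
  'd (f \o ci i) (ch i x) v =
  'd (f \o ci j) (ch j x) ('d (ch j \o ci i) (ch i x) v).
Proof.
move=> sf xi xj; have dij := transition_diff xi xj.
have e : (ch j \o ci i) (ch i x) = ch j x by rewrite /= chartK.
have dfj := smooth_on_differentiable (sf j) (in_chart xj).
apply: etrans (diff_compE v dij dfj e).
have dcomp : differentiable ((f \o ci j) \o (ch j \o ci i)) (ch i x).
  by apply: (differentiable_comp dij); rewrite e; exact: dfj.
have idn : \forall y \near ch i x, ((f \o ci j) \o (ch j \o ci i)) y = (f \o ci i) y.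
  apply: (open_near (A := ch i @` (dom X i `&` dom X j))).
  - exact: open_overlap.
  - by move=> _ [y [yi yj] <-] /=; rewrite (chartK yi) (chartK yj).
  - by exists x.
have [_ e'] := near_eq_diff idn dcomp.
exact: (congr1 (fun h => h v) e').
Qed.

Lemma smooth_map_continuous q (f : X -> 'rV[R]_q) : smooth_map f -> continuous f.
Proof.
move=> sf x; have [i xi] := @dom_cover R d X x.
have cf : {for ch i x, continuous (f \o ci i)}.
  exact: (sf i 0 _ (in_chart xi)).
have := @chart_continuous R d X i.
rewrite (continuous_open_subspace _ (@dom_open R d X i)) => c.
have cx : {for x, continuous (ch i)} by apply: c; rewrite inE.
have e : (f \o ci i) (ch i x) = f x by rewrite /= chartK.
have : ((f \o ci i) \o ch i) @ x --> (f \o ci i) (ch i x).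
  exact: continuous_comp cx cf.
rewrite e; apply: cvg_trans; apply: near_eq_cvg.
apply: (open_near (@dom_open R d X i)) xi => y yi /=.
by rewrite chartK.
Qed.

End ManifoldMaps.

(** * Bump functions and an embedding of a compact manifold *)

Section Bump.
Variables (R : realType) (d : nat).
Implicit Types (c y : 'rV[R]_d) (r : R).

(** Balls of the sup norm are cubes, so a product of one-dimensional bumps is positive on the open
    ball and zero off the closed one. *)
Definition bump c r y : R :=
  \prod_i (flat 0 (r - (y 0 i - c 0 i)) * flat 0 (r + (y 0 i - c 0 i))).

Lemma bump_gt0 c r y : `|y - c| < r -> 0 < bump c r y.
Proof.
move=> yr; apply: prodr_gt0 => i _.
have : `|y 0 i - c 0 i| < r.
  by apply: le_lt_trans yr; have := norm_rV_ge (y - c) i; rewrite !mxE.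
by rewrite ltr_norml => /andP[l1 l2]; apply: mulr_gt0; apply: flat_gt0; lra.
Qed.

Lemma bump_neq0 c r y : 0 <= r -> bump c r y != 0 -> `|y - c| <= r.
Proof.
move=> r0 /prodf_neq0 h; apply: norm_rV_le => // i; rewrite !mxE ler_norml.
have := h i isT; rewrite mulf_eq0 negb_or => /andP[h1 h2].
apply/andP; split; rewrite leNgt; apply/negP => lt.
  by move: h2; rewrite flat_le0 ?eqxx //; lra.
by move: h1; rewrite flat_le0 ?eqxx //; lra.
Qed.

Lemma smooth_coord (i : 'I_d) : smooth_on setT (fun y : 'rV[R]_d => y 0 i).
Proof. by move=> k; apply: Ck_on_mxE openT _; exact: smooth_on_id openT k. Qed.

Lemma smooth_bump c r : smooth_on setT (bump c r).
Proof.
move=> k; apply: Ck_on_prod openT _ => i.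
have sc (a : R) : smooth_on setT (fun y : 'rV[R]_d => a + y 0 i).
  by move=> l; apply: Ck_onD openT (Ck_on_cst l a openT) (smooth_coord i l).
have sn (a : R) : smooth_on setT (fun y : 'rV[R]_d => a + (-1) * y 0 i).
  move=> l; apply: Ck_onD openT (Ck_on_cst l a openT) _.
  exact: Ck_onM openT (Ck_on_cst l (-1 : R) openT) (smooth_coord i l).
apply: Ck_onM openT _ _.
  have := Ck_on_comp1 openT (sn (r + c 0 i)) (@smooth_flat R 0 k).
  apply: Ck_on_eq openT _.
  by move=> y _ /=; congr flat; ring.
have := Ck_on_comp1 openT (sc (r - c 0 i)) (@smooth_flat R 0 k).
apply: Ck_on_eq openT _.
by move=> y _ /=; congr flat; ring.
Qed.

End Bump.

Section CompactEmbedding.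
Variables (R : realType) (d : nat) (X : smooth_manifold R d).
Local Notation ch := (chart X).
Local Notation ci := (chart_inv X).
Local Notation U i := (ch i @` dom X i).

Definition extend0 q (Phi : 'rV[R]_d -> 'rV[R]_q) i (p : X) : 'rV[R]_q :=
  if `[< dom X i p >] then Phi (ch i p) else 0.

(** The image of [K] in [X] is compact, hence closed as [X] is Hausdorff. The domain of the chart
    and the complement of this image cover [X], and the extension is smooth on the former and zero
    on the latter. *)
Lemma smooth_extend0 q (Phi : 'rV[R]_d -> 'rV[R]_q) i (K : set 'rV[R]_d) :
  compact K -> K `<=` U i -> smooth_on setT Phi ->
  (forall y, ~ K y -> Phi y = 0) -> smooth_map (extend0 Phi i).
Proof.
move=> cK KU sPhi Phi0 j k.
have clK : closed (ci i @` K).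
  apply: compact_closed; first exact: manifold_hausdorff.
  apply: continuous_compact => //; apply: continuous_subspaceW KU _.
  exact: chart_inv_continuous.
have oC : open (~` (ci i @` K)) by apply: closed_openC.
apply: Ck_on_local => y Uy; have [pj chp] := dom_chart_inv Uy.
have [pi|pi] := pselect (dom X i (ci j y)).
  exists (ch j @` (dom X j `&` dom X i)); first by exists (ci j y).
  have Ck := Ck_on_comp (@open_overlap _ _ X j i) openT (fun _ _ => I)
    (@transition_smooth R d X j i) (sPhi k).
  apply: Ck_on_eq (@open_overlap _ _ X j i) _ Ck => _ [x [xj xi] <-].
  rewrite /= chartK // /extend0; case: asboolP => // nx.
have oA := open_chart_inv_preimage (i := j) oC.
exists [set z | U j z /\ (~` (ci i @` K)) (ci j z)].
  split=> // -[z Kz zy]; apply: pi; rewrite -zy.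
  by have [] := dom_chart_inv (KU _ Kz).
apply: Ck_on_eq oA _ (Ck_on_cst k (0 : 'rV[R]_q) oA) => z [_ nz] /=.
rewrite /extend0; case: asboolP => // zi; rewrite Phi0 // => Kz; apply: nz.
by exists (ch i (ci j z)) => //; rewrite chartK.
Qed.

Lemma chart_closed_ball x : exists i r, [/\ dom X i x, 0 < r &
  [set y | `|y - ch i x| <= r] `<=` U i].
Proof.
have [i xi] := @dom_cover R d X x.
have /nbhs_ballP[r /= r0 rU] : nbhs (ch i x) (U i).
  by apply: open_nbhs_nbhs; split; [exact: chart_open|exact: in_chart].
exists i, (r / 2); split=> //; first by rewrite divr_gt0.
move=> y /= yr; apply: rU; rewrite -ball_normE /= distrC.
by apply: le_lt_trans yr _; rewrite ltr_pdivrMr // ltr_pMr // ltr1n.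
Qed.

Lemma compact_closed_ball (c : 'rV[R]_d) r : compact [set y | `|y - c| <= r].
Proof.
apply: bounded_closed_compact.
  exists (`|c| + r); split; first exact: num_real.
  move=> M /ltW Mr y /= yr; apply: le_trans Mr.
  rewrite -(subrK c y); apply: le_trans (ler_normD _ _) _; rewrite addrC lerD2l.
  exact: yr.
rewrite (_ : [set y | _] = (fun y => `|y - c|) @^-1` [set x | x <= r]) //.
apply: closed_comp; last exact: closed_le.
move=> y _; apply: continuous_comp; last exact: norm_continuous.
apply: continuousB; [exact: cvg_id|exact: cst_continuous].
Qed.

(** Where the bump [b] is nonzero, the pair [(b, b y)] recovers the chart coordinate [y]; its first
    entry also separates these points from those outside the chart domain. *)
Definition bumped (c : 'rV[R]_d) r (y : 'rV[R]_d) : 'rV[R]_(1 + d) :=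
  row_mx (bump c r y)%:M (bump c r y *: y).

Lemma smooth_bumped c r : smooth_on setT (bumped c r).
Proof.
move=> k; apply: Ck_on_row_mx openT _ _; apply: Ck_on_mx openT _ => i j.
  apply: Ck_on_eq openT _ (@smooth_bump R d c r k) => y _.
  by rewrite !ord1 mxE mulr1n.
have := Ck_onM openT (@smooth_bump R d c r k) (@smooth_coord R d j k).
by apply: Ck_on_eq openT _ => y _; rewrite (ord1 i) mxE.
Qed.

Lemma compact_finite_subcover (V : X -> set X) : compact [set: X] ->
  (forall x, open (V x)) -> (forall x, V x x) ->
  exists N (xs : 'I_N -> X), forall p, exists k, V (xs k) p.
Proof.
(* The covering form of compactness is applied to a pointed type, so the empty manifold is treated
   apart. *)
move=> cX0 oV Vx; have [[x0 _]|X0] := pselect ([set: X] !=set0); last first.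
  have noX (p : X) : False by apply: X0; exists p.
  by exists 0%N, (fun k : 'I_0 => match notF (ltn_ord k) with end) => p; case: (noX p).
pose T : ptopologicalType :=
  HB.pack (Topological.sort (carrier X)) (isPointed.Build (Topological.sort (carrier X)) x0).
have cX : @cover_compact T setT by rewrite -compact_cover; exact: cX0.
have [|D _ cov] := cX X setT V (fun x _ => oV x); first by move=> x _; exists x.
pose s : seq X := finmap.enum_fset D.
exists (size s), (fun k => tnth (in_tuple s) k) => p.
have [x /= xD Vxp] := cov p I; have xs_ : x \in s by [].
have kN : (index x s < size s)%N by rewrite index_mem.
by exists (Ordinal kN); rewrite (tnth_nth x) /= nth_index.
Qed.

Lemma compact_embedding : compact [set: X] -> exists q (f : X -> 'rV[R]_q), embedding f.
Proof.
move=> cX.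
have /choice[ic /choice[rc hc]] := chart_closed_ball.
pose V x : set X := [set p | dom X (ic x) p /\ `|ch (ic x) p - ch (ic x) x| < rc x].
have oV x : open (V x).
  apply: (@open_chart_preimage R d X (ic x) [set y | `|y - ch (ic x) x| < rc x]).
  rewrite (_ : [set y | _] = ball (ch (ic x) x) (rc x)); first exact: ball_open.
  by apply/seteqP; split=> y; rewrite -ball_normE /= distrC.
have [|N [xs covk]] := compact_finite_subcover cX oV.
  by move=> x; split; have [xi r0 _] := hc x; rewrite // subrr normr0.
pose F (k : 'I_N) : X -> 'rV[R]_(1 + d) :=
  extend0 (bumped (ch (ic (xs k)) (xs k)) (rc (xs k))) (ic (xs k)).
pose f p := mxvec (\matrix_(k < N) F k p).
have sF k : smooth_map (F k).
  have [xi r0 cU] := hc (xs k).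
  apply: (smooth_extend0 (@compact_closed_ball _ _) cU (@smooth_bumped _ _)) => y ny.
  have b0 : bump (ch (ic (xs k)) (xs k)) (rc (xs k)) y = 0.
    by apply/eqP/negPn/negP => /(bump_neq0 (ltW r0)).
  by rewrite /bumped b0 scale0r raddf0 row_mx0.
have sf : smooth_map f.
  move=> j l; have oU := @chart_open R d X j; apply: (Ck_on_mxvec oU).
  apply: (Ck_on_mx oU) => k c.
  have := Ck_on_mxE 0 c oU (sF k j l).
  by apply: Ck_on_eq oU _ => y _; rewrite !mxE.
have Ff k p q : f p = f q -> F k p = F k q.
  move=> /(can_inj mxvecK)/matrixP e; apply/rowP => c.
  by have := e k c; rewrite !mxE.
exists (N * (1 + d))%N, f; split => //.
  move=> p q fpq; have [k [pi Vp]] := covk p.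
  have := Ff k _ _ fpq; rewrite /F /extend0 asboolT //.
  have b0 := bump_gt0 Vp.
  case: asboolP => [qi|_].
    move=> /eq_row_mx[/(congr1 (fun A : 'M[R]_1 => A 0 0))].
    rewrite !mxE !mulr1n => <- /(scalerI (lt0r_neq0 b0)) e.
    by rewrite -(chartK pi) e chartK.
  rewrite -row_mx0 => /eq_row_mx[/(congr1 (fun A : 'M[R]_1 => A 0 0))].
  by rewrite !mxE mulr1n => b00; move: b0; rewrite b00 ltxx.
move=> j p v pj dfv; have [k [pi Vp]] := covk p.
(* In the chart of the block [k], the derivative of [(b, b y)] along [w] is
   [(db(w), b w + db(w) y)]. If it vanishes, so does [w], because [b] is positive at [p]. *)
have dF0 : 'd (F k \o ci j) (ch j p) v = 0.
  apply/rowP => c.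
  have df := smooth_on_differentiable (sf j) (in_chart pj).
  have dF := smooth_on_differentiable (sF k j) (in_chart pj).
  have [_ e1] := diff_mxE v 0 c dF.
  have [_] := diff_mxE v 0 (mxvec_index k c) df.
  have -> : (fun y => (f \o ci j) y 0 (mxvec_index k c)) =
      (fun y => (F k \o ci j) y 0 c).
    by apply/funext => y; rewrite /= mxvecE mxE.
  by rewrite dfv e1 => ->; rewrite !mxE.
set i := ic (xs k) in pi Vp *.
pose w := 'd (ch i \o ci j) (ch j p) v.
have w0 : 'd (F k \o ci i) (ch i p) w = 0 by rewrite /w -diff_change_chart.
suff : w = 0.
  move=> w00; apply: etrans (esym (transition_diffK v pj pi)) _.
  exact: etrans (congr1 ('d (ch j \o ci i) (ch i p)) w00) (linear0 _).
set c := ch i (xs k) in Vp; set r := rc (xs k) in Vp.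
have E y : U i y -> (F k \o ci i) y = bumped c r y.
  move=> Uy; have [yi ye] := dom_chart_inv Uy.
  by rewrite /F /= /extend0 asboolT // -/i ye.
have db : 'd (bumped c r) (ch i p) w = 0.
  have dF := smooth_on_differentiable (sF k i) (in_chart pi).
  have nE := open_near (@chart_open R d X i) E (in_chart pi).
  have [_ e'] := near_eq_diff nE dF.
  exact: etrans (congr1 (fun h => h w) e') w0.
have dbd := smooth_on_differentiable (@smooth_bumped c r) (I : [set: 'rV[R]_d] (ch i p)).
have b0 := bump_gt0 Vp.
have dB : 'd (bump c r) (ch i p) w = 0.
  have [_] := diff_mxE w 0 (lshift d 0) dbd; rewrite db mxE => <-.
  congr ('d _ _ _); apply/funext => y.
  by rewrite row_mxEl mxE mulr1n.
apply/rowP => l; rewrite mxE.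
have dbump := smooth_on_differentiable (@smooth_bump R d c r) (I : [set: 'rV[R]_d] (ch i p)).
have dcoord := smooth_on_differentiable (@smooth_coord R d l) (I : [set: 'rV[R]_d] (ch i p)).
have [_] := diff_mxE w 0 (rshift 1 l) dbd; rewrite db [RHS]mxE.
rewrite (_ : (fun y => _) = bump c r * (fun y : 'rV[R]_d => y 0 l)); last first.
  by apply/funext => y; rewrite row_mxEr mxE.
have e : 'd (bump c r * (fun y : 'rV[R]_d => y 0 l)) (ch i p) w =
    bump c r (ch i p) * 'd (fun y : 'rV[R]_d => y 0 l) (ch i p) w +
    (ch i p) 0 l * 'd (bump c r) (ch i p) w.
  exact: (congr1 (fun h => h w) (diffM dbump dcoord)).
rewrite e dB mulr0 addr0.
have did : differentiable (@id 'rV[R]_d) (ch i p) by exact: ex_diff.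
have [_ ->] := diff_mxE w 0 l did; rewrite diff_val => /eqP.
by rewrite mulf_eq0 gt_eqF //= => /eqP.
Qed.

End CompactEmbedding.

(** * Generic projections and reduction of the dimension *)

Lemma rank1_projection (F : fieldType) (q : nat) (u : 'rV[F]_q.+1) : u != 0 ->
  exists P : 'M[F]_(q.+1, q), forall w : 'rV_q.+1, w *m P = 0 ->
    exists t, w = t *: u.
Proof.
move=> u0; have rk : \rank (cokermx u) = q.
  by rewrite mxrank_coker rank_rV u0 subn1.
have [L [B [C [defK _ _]]]] := full_rank_factorization rk.
exists L => w wL; apply/sub_rVP.
by rewrite submxE defK mulmxA wL mul0mx.
Qed.

Section DimensionReduction.
Variables (R : realType) (d : nat) (X : smooth_manifold R d).
Local Notation ch := (chart X).
Local Notation ci := (chart_inv X).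
Local Notation U i := (ch i @` dom X i).

Lemma Ck_on_scale (V : normedModType R) k (A : set V) p q (s : V -> R)
    (F : V -> 'M[R]_(p, q)) : open A ->
  Ck_on k A s -> Ck_on k A F -> Ck_on k A (fun x => s x *: F x).
Proof.
move=> oA Cs CF; apply: (Ck_on_mx oA) => i j.
have := Ck_onM oA Cs (Ck_on_mxE i j oA CF).
by apply: (Ck_on_eq oA) => x _; rewrite mxE.
Qed.

Lemma smooth_lsubmx a b :
  smooth_on setT (fun z : 'rV[R]_(a + b) => lsubmx z : 'rV[R]_a).
Proof.
move=> k; apply: (Ck_on_mx openT) => i j.
have := Ck_on_mxE i (lshift b j) openT (@smooth_on_id R 'rV[R]_(a + b) _ openT k).
by apply: (Ck_on_eq openT) => x _; rewrite mxE.
Qed.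

Lemma smooth_rsubmx a b :
  smooth_on setT (fun z : 'rV[R]_(a + b) => rsubmx z : 'rV[R]_b).
Proof.
move=> k; apply: (Ck_on_mx openT) => i j.
have := Ck_on_mxE i (rshift a j) openT (@smooth_on_id R 'rV[R]_(a + b) _ openT k).
by apply: (Ck_on_eq openT) => x _; rewrite mxE.
Qed.

Lemma open_smooth_preimage p q (t : 'rV[R]_p -> 'rV[R]_q) (B : set 'rV[R]_q) :
  smooth_on setT t -> open B -> open (t @^-1` B).
Proof. by move=> st; apply: open_comp => x _; exact: (st 0 x I). Qed.

Definition secants q (f : X -> 'rV[R]_q) : set 'rV[R]_q :=
  [set w | exists t x y, w = t *: (f x - f y)].

Definition tangents q (f : X -> 'rV[R]_q) : set 'rV[R]_q :=
  [set w | exists i x v, dom X i x /\ w = 'd (f \o ci i) (ch i x) v].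

Lemma smooth_comp_chart p q (f : X -> 'rV[R]_q) i (t : 'rV[R]_p -> 'rV[R]_d)
    (A : set 'rV[R]_p) k : smooth_map f -> smooth_on setT t -> open A ->
  (forall z, A z -> U i (t z)) -> Ck_on k A (fun z => f (ci i (t z))).
Proof.
move=> sf st oA AU; have stA : smooth_on A t.
  by move=> l; apply: Ck_on_sub (st l).
exact: (Ck_on_comp oA (@chart_open R d X i) AU stA (sf i k)).
Qed.

(* Secants are parametrized by [2 d + 1] real numbers, tangents by [2 d]. *)
Lemma meager_secants q (f : X -> 'rV[R]_q) : compact [set: X] -> smooth_map f ->
  (2 * d + 1 < q)%N -> meager (secants f).
Proof.
move=> cX sf dq.
have [ic icx] := choice (@dom_cover R d X).
have [|//|N [xs cov]] := compact_finite_subcover cX (V := fun x => dom X (ic x)).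
  by move=> x; exact: dom_open.
pose c k := ic (xs k).
pose y1 (z : 'rV[R]_(1 + d + d)) : 'rV[R]_d := rsubmx (lsubmx z).
pose y2 (z : 'rV[R]_(1 + d + d)) : 'rV[R]_d := rsubmx z.
pose g (kl : 'I_N * 'I_N) (z : 'rV[R]_(1 + d + d)) : 'rV[R]_q :=
  lsubmx (lsubmx z) 0 0 *: (f (ci (c kl.1) (y1 z)) - f (ci (c kl.2) (y2 z))).
pose S (kl : 'I_N * 'I_N) := y1 @^-1` (U (c kl.1)) `&` y2 @^-1` (U (c kl.2)).
have sl := @smooth_lsubmx (1 + d) d.
have s1 : smooth_on setT y1.
  move=> k; exact: (Ck_on_comp openT openT (fun _ _ => I) sl (@smooth_rsubmx 1 d k)).
have s0 : smooth_on setT (fun z : 'rV[R]_(1 + d + d) => lsubmx (lsubmx z) : 'rV[R]_1).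
  move=> k; exact: (Ck_on_comp openT openT (fun _ _ => I) sl (@smooth_lsubmx 1 d k)).
have s2 : smooth_on setT y2 := @smooth_rsubmx (1 + d) d.
have oS kl : open (S kl).
  by apply: openI; apply: open_smooth_preimage => //; exact: chart_open.
apply: (meager_sub (B := \bigcup_kl (g kl @` S kl))); last first.
  apply: meager_bigcup => kl; apply: meager_image; first by rewrite -addnA addnn -mul2n addnC.
  move=> z Sz; apply: (smooth_on_differentiable (A := S kl)) Sz => k.
  apply: (Ck_on_scale (oS kl)).
    apply: (Ck_on_mxE 0 0 (oS kl)); exact: Ck_on_sub (s0 k).
  have C1 : Ck_on k (S kl) (fun z => f (ci (c kl.1) (y1 z))).
    by apply: (smooth_comp_chart k sf s1 (oS kl)) => x [].
  have C2 : Ck_on k (S kl) (fun z => f (ci (c kl.2) (y2 z))).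
    by apply: (smooth_comp_chart k sf s2 (oS kl)) => x [].
  have := Ck_onD (oS kl) C1 (Ck_on_scale (oS kl) (Ck_on_cst k (-1 : R) (oS kl)) C2).
  by apply: (Ck_on_eq (oS kl)) => x _; rewrite scaleN1r.
move=> _ [t [x [y ->]]]; have [k xk] := cov x; have [l yl] := cov y.
exists (k, l) => //; exists (row_mx (row_mx t%:M (ch (c k) x)) (ch (c l) y)).
  by rewrite /S /y1 /y2 /= row_mxKl !row_mxKr; split; exact: in_chart.
rewrite /g /y1 /y2 /= !row_mxKl !row_mxKr !chartK //.
by rewrite mxE mulr1n.
Qed.

Lemma meager_tangents q (f : X -> 'rV[R]_q) : compact [set: X] -> smooth_map f ->
  (2 * d + 1 < q)%N -> meager (tangents f).
Proof.
move=> cX sf dq.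
have [ic icx] := choice (@dom_cover R d X).
have [|//|N [xs cov]] := compact_finite_subcover cX (V := fun x => dom X (ic x)).
  by move=> x; exact: dom_open.
pose c k := ic (xs k).
pose y1 (z : 'rV[R]_(d + d)) : 'rV[R]_d := lsubmx z.
pose y2 (z : 'rV[R]_(d + d)) : 'rV[R]_d := rsubmx z.
pose F k (i : 'I_d) (y : 'rV[R]_d) : 'rV[R]_q := 'd (f \o ci (c k)) y (delta_mx 0 i).
pose g k (z : 'rV[R]_(d + d)) : 'rV[R]_q := \sum_i y2 z 0 i *: F k i (y1 z).
pose S k := y1 @^-1` (U (c k)).
have s1 : smooth_on setT y1 := @smooth_lsubmx d d.
have s2 : smooth_on setT y2 := @smooth_rsubmx d d.
have oS k : open (S k) by apply: open_smooth_preimage => //; exact: chart_open.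
apply: (meager_sub (B := \bigcup_k (g k @` S k))); last first.
  apply: meager_bigcup => k; apply: meager_image.
    by rewrite addnn -mul2n (leq_trans _ dq) // addn1.
  move=> z Sz; apply: (smooth_on_differentiable (A := S k)) Sz => l.
  apply: (Ck_on_sum _ (oS k)) => i; apply: (Ck_on_scale (oS k)).
    by apply: (Ck_on_mxE 0 i (oS k)); exact: Ck_on_sub (s2 l).
  have sF : smooth_on (U (c k)) (F k i) by apply: smooth_on_diff; exact: sf.
  have s1S : smooth_on (S k) y1 by move=> h; apply: Ck_on_sub (s1 h).
  exact: (Ck_on_comp (oS k) (@chart_open R d X (c k)) (fun x Sx => Sx) s1S (sF l)).
move=> _ [i [x [v [xi ->]]]]; have [k xk] := cov x.
rewrite (diff_change_chart v sf xi xk); set w := 'd _ _ v.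
exists k => //; exists (row_mx (ch (c k) x) w).
  by rewrite /S /y1 /= row_mxKl; exact: in_chart.
rewrite /g /y1 /y2 row_mxKl row_mxKr [in RHS](row_sum_delta w) linear_sum.
by apply: eq_bigr => j _; rewrite linearZ.
Qed.

Lemma diff_mulmxr (V : normedModType R) p q r (F : V -> 'M[R]_(p, q))
    (P : 'M[R]_(q, r)) x v : differentiable F x ->
  differentiable (fun y => F y *m P) x /\
  'd (fun y => F y *m P) x v = 'd F x v *m P.
Proof.
move=> dF; have cP : continuous (mulmxr P : 'M[R]_(p, q) -> 'M[R]_(p, r)).
  move=> M; have C0 := Ck_on_mulmx openT (@smooth_on_id R 'M[R]_(p, q) _ openT 0)
    (Ck_on_cst 0 P openT).
  exact: (C0 M I).
have dP : differentiable (mulmxr P : 'M[R]_(p, q) -> 'M[R]_(p, r)) (F x).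
  exact: linear_differentiable.
split; first exact: (differentiable_comp dF dP).
by apply: etrans (diff_compE v dF dP erefl) _; rewrite diff_lin.
Qed.

Lemma embedding_reduce q (f : X -> 'rV[R]_q.+1) : compact [set: X] ->
  (2 * d + 1 <= q)%N -> embedding f -> exists g : X -> 'rV[R]_q, embedding g.
Proof.
move=> cX dq [sf injf immf].
(* Zero needs separate exclusion when [X] is empty, as there are then no secants; it is the image of
   a space of dimension 0. *)
have m0 : meager [set (0 : 'rV[R]_q.+1)].
  apply: (meager_sub (B := (fun _ : 'rV[R]_0 => 0) @` setT)).
    by move=> _ ->; exists 0.
  by apply: meager_image => // x _; exact: differentiable_cst.
pose B (k : 'I_3) := if k == 0 :> nat then secants f else
  if k == 1%N :> nat then tangents f else [set 0].
have : meager (\bigcup_k B k).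
  apply: meager_bigcup => k; rewrite /B; case: ifP => _; first exact: meager_secants.
  by case: ifP => // _; exact: meager_tangents.
move=> /meager_compl[u nBu].
have u0 : u != 0.
  by apply/eqP => u0; apply: nBu; exists (inord 2) => //; rewrite /B !inordK.
have nsec : ~ secants f u.
  by move=> su; apply: nBu; exists (inord 0) => //; rewrite /B !inordK.
have ntan : ~ tangents f u.
  by move=> su; apply: nBu; exists (inord 1) => //; rewrite /B !inordK.
have [P hP] := rank1_projection u0.
exists (fun x => f x *m P); split.
- move=> i k; have oU := @chart_open R d X i.
  exact: (Ck_on_mulmx oU (sf i k) (Ck_on_cst k P oU)).
- move=> x y /eqP; rewrite -subr_eq0 -mulmxBl => /eqP/hP[t e].
  have [t0|t0] := eqVneq t 0.
    by apply: injf; apply/eqP; rewrite -subr_eq0 e t0 scale0r.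
  by case: nsec; exists t^-1, x, y; rewrite e scalerA mulVf // scale1r.
- move=> i x v xi.
  have df := smooth_on_differentiable (sf i) (in_chart xi).
  have [_ ->] := diff_mulmxr P v df; move=> /hP[t e].
  have [t0|t0] := eqVneq t 0.
    by apply: (immf i x) => //; rewrite e t0 scale0r.
  case: ntan; exists i, x, (t^-1 *: v); split=> //.
  by rewrite linearZ /= e scalerA mulVf // scale1r.
Qed.

Lemma embedding_pad q r (f : X -> 'rV[R]_q) : embedding f ->
  embedding (fun x => row_mx (f x) (0 : 'rV[R]_r)).
Proof.
move=> [sf injf immf].
have E x : row_mx (f x) (0 : 'rV[R]_r) = f x *m row_mx 1%:M 0.
  by rewrite mul_mx_row mulmx1 mulmx0.
split.
- move=> i k; have oU := @chart_open R d X i.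
  exact: (Ck_on_row_mx oU (sf i k) (Ck_on_cst k 0 oU)).
- by move=> x y /eq_row_mx[/injf].
- move=> i x v xi.
  have df := smooth_on_differentiable (sf i) (in_chart xi).
  have [_] := diff_mulmxr (row_mx 1%:M (0 : 'M[R]_(q, r))) v df.
  rewrite (_ : (fun y => _) = (fun x => row_mx (f x) 0) \o ci i) => [->|].
    rewrite mul_mx_row mulmx1 mulmx0 -row_mx0 => /eq_row_mx[h _].
    exact: (immf i x).
  by apply/funext => y; rewrite /= E.
Qed.

Lemma whitney_embedding q : compact [set: X] -> (2 * d + 1 <= q)%N ->
  exists f : X -> 'rV[R]_q, embedding f.
Proof.
move=> cX dq; have [r [f ef]] := compact_embedding cX.
(* Padding by [q] zeros guarantees a dimension [q + r] of at least [q]; the projections then remove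
   the [r] extra dimensions one by one. *)
have [g eg] : exists g : X -> 'rV[R]_(q + r), embedding g.
  have [f' ef'] : exists f' : X -> 'rV[R]_(r + q), embedding f'.
    by exists (fun x => row_mx (f x) 0); exact: embedding_pad.
  by move: f' ef'; rewrite addnC => f' ef'; exists f'.
elim: r g eg {f ef} => [|r IH]; first by rewrite addn0 => g eg; exists g.
rewrite addnS => g eg; have [|g' eg'] := embedding_reduce cX _ eg; last exact: IH eg'.
by rewrite (leq_trans dq) // leq_addr.
Qed.

End DimensionReduction.

(** * Embedding an almost complex manifold *)

Section RealMatrices.
Variables (R : realFieldType) (d a : nat).
Implicit Types (A : 'M[R]_(d, a)) (J : 'M[R]_d).

(** If [x] kills the Gram matrix, then [x A] has zero Euclidean norm; the order on [R] is essential
    here. *)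
Lemma gram_unitmx A : row_free A -> A *m A^T \in unitmx.
Proof.
move=> fA; rewrite -row_free_unit; apply: inj_row_free => x xG.
have xA : x *m A = 0.
  have /matrixP/(_ 0 0) : (x *m A) *m (x *m A)^T = 0.
    by rewrite trmx_mul mulmxA -(mulmxA x) xG mul0mx.
  rewrite !mxE => s0; apply/rowP => i; rewrite [RHS]mxE.
  have := s0; rewrite (eq_bigr (fun k => (x *m A) 0 k ^+ 2)); last first.
    by move=> k _; rewrite [_^T _ _]mxE expr2.
  move/eqP; rewrite psumr_eq0 => [/allP/(_ i)|k _]; last exact: sqr_ge0.
  by rewrite mem_index_enum => /(_ isT) /=; rewrite sqrf_eq0 => /eqP.
have [B AB] := row_freeP fA.
by rewrite -[x]mulmx1 -AB mulmxA xA mul0mx.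
Qed.

Definition pseudoinv A : 'M[R]_(a, d) := A^T *m invmx (A *m A^T).

Lemma mul_pseudoinv A : row_free A -> A *m pseudoinv A = 1%:M.
Proof. by move=> fA; rewrite mulmxA mulmxV // gram_unitmx. Qed.

(* The endomorphism of [R^a] equal to [J] on the row space of [A] (the tangent
   space) and to [0] on its orthogonal complement. *)
Definition extendJ A J : 'M[R]_a := pseudoinv A *m J *m A.

Lemma mul_extendJ A J : row_free A -> A *m extendJ A J = J *m A.
Proof.
move=> fA; rewrite /extendJ; move: (pseudoinv A) (mul_pseudoinv fA) => B AB.
by rewrite !mulmxA AB mul1mx.
Qed.

Lemma extendJ_perp A J q (w : 'M[R]_(q, a)) : w *m A^T = 0 -> w *m extendJ A J = 0.
Proof. by move=> wA; rewrite /extendJ /pseudoinv !mulmxA wA !mul0mx. Qed.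

Lemma extendJ_unique A J (j : 'M[R]_a) : row_free A -> A *m j = J *m A ->
  (forall w : 'rV[R]_a, w *m A^T = 0 -> w *m j = 0) -> j = extendJ A J.
Proof.
move=> fA Aj perp; apply/row_matrixP => k; rewrite !rowE.
move: (delta_mx 0 k) => w; pose u := w *m pseudoinv A.
have r0 : (w - u *m A) *m A^T = 0.
  by rewrite /u mulmxBl /pseudoinv -!mulmxA mulVmx ?gram_unitmx // mulmx1 subrr.
have -> : w = u *m A + (w - u *m A) by rewrite addrC subrK.
move: (w - u *m A) r0 => r r0; rewrite !mulmxDl (perp _ r0) (extendJ_perp _ r0) !addr0.
by rewrite -!(mulmxA u) Aj mul_extendJ.
Qed.

(** Both sides act in the same way on the common row space and vanish on its orthogonal complement.
    This is what makes the extension independent of the chart. *)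
Lemma extendJ_change (T : 'M[R]_d) A A' J J' : T \in unitmx -> row_free A' ->
  A = T *m A' -> J *m T = T *m J' -> row_free A -> extendJ A J = extendJ A' J'.
Proof.
move=> uT fA' AT JT fA; apply: extendJ_unique => //.
  have := mul_extendJ J fA; rewrite {1 3}AT -!mulmxA (mulmxA J) JT -mulmxA.
  by move/(congr1 (mulmx (invmx T))); rewrite !mulKmx.
by move=> w wA'; apply: extendJ_perp; rewrite AT trmx_mul mulmxA wA' mul0mx.
Qed.

Variables (A : 'M[R]_(d, a)) (J : 'M[R]_d).
Hypotheses (fA : row_free A) (JJ : J *m J = - 1%:M).

Lemma extendJ_sqr : extendJ A J *m extendJ A J = - (pseudoinv A *m A).
Proof.
rewrite {1}/extendJ -mulmxA mul_extendJ //; move: (pseudoinv A) => B.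
by rewrite -mulmxA (mulmxA J) JJ mulNmx mul1mx mulmxN.
Qed.

Lemma extendJ_cube :
  extendJ A J *m extendJ A J *m extendJ A J + extendJ A J = 0.
Proof.
rewrite extendJ_sqr mulNmx -mulmxA mul_extendJ // /extendJ.
by move: (pseudoinv A) => B; rewrite mulmxA addNr.
Qed.

Lemma mxtrace_extendJ : \tr (extendJ A J) = \tr J.
Proof.
rewrite /extendJ; move: (pseudoinv A) (mul_pseudoinv fA) => B AB.
by rewrite mxtrace_mulC mulmxA AB mul1mx.
Qed.

Lemma mxtrace_extendJ_sqr : \tr (extendJ A J *m extendJ A J) = - d%:R.
Proof. by rewrite extendJ_sqr raddfN /= mxtrace_mulC mul_pseudoinv // mxtrace1. Qed.

End RealMatrices.

(** * Complexification of a linear complex structure *)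

Section ComplexStructure.
Variables (R : realType) (d a : nat).
Local Notation C := R[i].
Local Notation RC := (map_mx (real_complex R)).
Variables (A : 'M[R]_(d, a)) (J : 'M[R]_d).
Hypotheses (fA : row_free A) (JJ : J *m J = - 1%:M).

(** The projector [(1 - i J) / 2] has trace [(d - i \tr J) / 2], which is a rank and hence a real
    number. *)
Lemma mxtrace_complex_structure : \tr J = 0.
Proof.
pose P : 'M[C]_d := 2^-1 *: (1%:M - 'i *: RC J).
have JC : RC J *m RC J = - 1%:M by rewrite -map_mxM JJ map_mxN map_mx1.
have PP : P *m P = P.
  have : ('i *: RC J) *m ('i *: RC J) = 1%:M :> 'M[C]_d.
    by rewrite -scalemxAl -scalemxAr scalerA JC -expr2 sqrCi scaleN1r opprK.
  rewrite /P; move: ('i *: RC J) => Y YY.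
  rewrite -scalemxAl -scalemxAr; congr (_ *: _).
  rewrite mulmxBl mul1mx mulmxBr mulmx1 YY; move: (1%:M) => I1.
  by apply/matrixP => k l; rewrite !mxE; field.
have := mxtrace_idempotent PP; rewrite /P mxtraceZ raddfB /= mxtrace1 mxtraceZ.
rewrite trace_map_mx -complexiE => h.
have {h} : d%:R - 'i%C * (\tr J)%:C%C = (\rank P)%:R * 2 :> C.
  by rewrite -h mulrAC mulVf ?mul1r // pnatr_eq0.
move=> /(congr1 (@complex.Im R)).
rewrite -natrM -!(rmorph_nat (real_complex R)) /= => h.
by apply/eqP; rewrite -oppr_eq0; apply/eqP; move: h; rewrite ?mul0r ?mul1r ?add0r ?addr0 ?sub0r.
Qed.

(** The projector of the complexified space onto the eigenspace of [J] for [i]. *)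
Definition holproj : 'M[C]_d := 2^-1 *: (1%:M - 'i *: RC J).

Lemma mul_holproj : RC J *m holproj = 'i *: holproj.
Proof.
have JC : RC J *m RC J = - 1%:M by rewrite -map_mxM JJ map_mxN map_mx1.
rewrite /holproj -scalemxAr [RHS]scalerA mulrC -scalerA; congr (_ *: _).
rewrite mulmxBr mulmx1 -scalemxAr JC scalerN opprK scalerBr scalerA -expr2 sqrCi.
by rewrite scaleN1r opprK addrC.
Qed.

(** At [c = i] the constant term [c^2 + 1] of [eproj] vanishes, so the projector factors through the
    row space of [A], where it is [holproj]. *)
Lemma eproj_extendJ :
  eproj 'i (RC (extendJ A J)) = RC (pseudoinv A) *m holproj *m RC A.
Proof.
rewrite /eproj -map_mxM extendJ_sqr // /extendJ; move: (pseudoinv A) => B.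
rewrite !map_mxM map_mxN map_mxM.
have i2 : ('i : C) ^+ 2 = -1 := sqrCi _.
rewrite i2 addNr raddf0 addr0 /holproj.
rewrite -scalemxAr -scalemxAl mulmxBr mulmx1 mulmxBl -scalemxAr -scalemxAl.
have -> : (3 * -1 + 1 : C)^-1 = - 2^-1.
  by rewrite (_ : 3 * -1 + 1 = - 2%:R) ?invrN //; ring.
move: (RC B *m RC A) ('i *: _) => Y W.
by rewrite scaleNr -scalerN opprD opprK.
Qed.

(** As [J] becomes [i] after [holproj], the vector [c1 + i c2] can be replaced by the real vector
    [c1 + c2 J]. With [holproj_real_inj], real vectors thus correspond bijectively to the
    eigenspace, which is the linear core of transversality. *)
Lemma real_holproj (c : 'rV[C]_d) : exists v : 'rV[R]_d,
  c *m holproj = RC v *m holproj.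
Proof.
pose c1 := map_mx (@complex.Re R) c; pose c2 := map_mx (@complex.Im R) c.
exists (c1 + c2 *m J).
have -> : c = RC c1 + 'i *: RC c2.
  by apply/rowP => k; rewrite !mxE {1}(complexE (c 0 k)) complexiE.
have := mul_holproj; move: holproj => H JH.
by rewrite map_mxD map_mxM !mulmxDl -(mulmxA _ (RC J)) JH -scalemxAl -scalemxAr.
Qed.

Lemma holproj_real_inj (v : 'rV[R]_d) : RC v *m holproj = 0 -> v = 0.
Proof.
move=> /(congr1 (fun w => 2 *: w)); rewrite /holproj -scalemxAr scalerA.
rewrite mulfV ?pnatr_eq0 // scale1r scaler0 mulmxBr mulmx1 -scalemxAr -map_mxM.
move=> /rowP h; apply/rowP => k; have := h k; rewrite !mxE -complexiE.
move=> /(congr1 (@complex.Re R)) /=.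
by rewrite ?mul0r ?mulr0 ?mul1r ?subr0 ?sub0r ?oppr0 ?addr0.
Qed.

End ComplexStructure.

Lemma diff_mulmx (R : realType) (V : normedModType R) p q r
    (F : V -> 'M[R]_(p, q)) (G : V -> 'M[R]_(q, r)) x v :
  differentiable F x -> differentiable G x ->
  'd (fun y => F y *m G y) x v = 'd F x v *m G x + F x *m 'd G x v.
Proof.
move=> dF dG.
have dk i k j : differentiable ((fun y => F y i k) * (fun y => G y k j)) x.
  apply: differentiableM; first by have [] := diff_mxE v i k dF.
  by have [] := diff_mxE v k j dG.
have eE i j : (fun y => (F y *m G y) i j) =
    \sum_k ((fun y => F y i k) * (fun y => G y k j)).
  by apply/funext => y; rewrite mxE fct_sumE.
have dFG : differentiable (fun y => F y *m G y) x.
  by apply: differentiable_mx => i j; rewrite eE; exact: differentiable_sum.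
apply/matrixP => i j; have [dij <-] := diff_mxE v i j dFG.
rewrite -(deriveE v dij) eE derive_sum => [|k]; last exact: diff_derivable.
rewrite !mxE -big_split; apply: eq_bigr => k _ /=.
have [d1 e1] := diff_mxE v i k dF; have [d2 e2] := diff_mxE v k j dG.
rewrite (deriveE v (dk i k j)).
apply: etrans (congr1 (fun h => h v) (diffM d1 d2)) _.
rewrite [LHS]/(F x i k * 'd (fun y => G y k j) x v + G x k j * 'd (fun y => F y i k) x v).
by rewrite e1 e2 addrC [G x k j * _]mulrC.
Qed.

(** * The map into the variety and its properties *)

Section AlmostComplexEmbedding.
Variables (R : realType) (n a e : nat) (X : almost_complex_manifold R n).
Variable phi : X -> 'rV[R]_a.
Hypothesis ephi : @embedding R (2 * n) X a phi.
Local Notation C := R[i].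
Local Notation RC := (map_mx (real_complex R)).
Local Notation ch := (chart X).
Local Notation ci := (chart_inv X).
Local Notation U i := (ch i @` dom X i).
Local Notation m := (a + a * a + e)%N.

Let sphi : smooth_map phi. Proof. by case: ephi. Qed.

Definition jac i (y : 'rV[R]_(2 * n)) : 'M[R]_(2 * n, a) :=
  lin1_mx ('d (phi \o ci i) y).

Lemma mul_jac i y v : v *m jac i y = 'd (phi \o ci i) y v.
Proof. exact: mul_rV_lin1. Qed.

Lemma jac_free i x : dom X i x -> row_free (jac i (ch i x)).
Proof.
move=> xi; apply: inj_row_free => v; rewrite mul_jac.
by have [_ _ imm] := ephi; exact: imm.
Qed.

Definition jchart i x : 'M[R]_a := extendJ (jac i (ch i x)) (acm_J i x).

Lemma jchart_change i l x : dom X i x -> dom X l x -> jchart i x = jchart l x.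
Proof.
move=> xi xl; pose T := lin1_mx ('d (ch l \o ci i) (ch i x)).
have mT v : v *m T = 'd (ch l \o ci i) (ch i x) v by exact: mul_rV_lin1.
apply: (extendJ_change (T := T)); try exact: jac_free.
- rewrite -row_free_unit; apply: inj_row_free => v; rewrite mT => v0.
  apply: etrans (esym (transition_diffK v xi xl)) _.
  exact: etrans (congr1 ('d (ch i \o ci l) (ch l x)) v0) (linear0 _).
- apply/row_matrixP => k; rewrite !rowE mulmxA mT !mul_jac.
  exact: diff_change_chart.
- apply/row_matrixP => k; rewrite !rowE !mulmxA !mT.
  exact: acm_J_transition.
Qed.

Lemma smooth_jac i : smooth_on (U i) (jac i).
Proof.
move=> k; have oU := @chart_open R _ X i; apply: (Ck_on_mx oU) => u v.
have := Ck_on_mxE 0 v oU (smooth_on_diff (delta_mx 0 u) (sphi i) k).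
by apply: (Ck_on_eq oU) => y _; rewrite mxE.
Qed.

Lemma smooth_jchart i : smooth_on (U i) (jchart i \o ci i).
Proof.
move=> k; have oU := @chart_open R _ X i; have CJ := acm_J_smooth (a := X) i k.
have Cj := smooth_jac i k.
have Cjt : Ck_on k (U i) (fun y => (jac i y)^T).
  apply: (Ck_on_mxsub (s := fun u v => (v, u)) oU _ Cj) => y u v.
  by rewrite mxE.
have Cinv : Ck_on k (U i) (fun y => invmx (jac i y *m (jac i y)^T)).
  apply: (Ck_on_invmx oU _ (Ck_on_mulmx oU Cj Cjt)) => _ [x xi <-].
  by apply: gram_unitmx; exact: jac_free.
have := Ck_on_mulmx oU (Ck_on_mulmx oU (Ck_on_mulmx oU Cjt Cinv) CJ) Cj.
apply: (Ck_on_eq oU) => y Uy; have [yi ye] := dom_chart_inv Uy.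
by rewrite /jchart /= ye.
Qed.

Definition chart_at (x : X) : chart_index X := projT1 (cid (dom_cover x)).

Lemma chart_atP x : dom X (chart_at x) x.
Proof. by rewrite /chart_at; case: cid. Qed.

(** The arbitrary chart is harmless by [jchart_change]; near any point a single chart may be used,
    whence smoothness. *)
Definition jmap x : 'M[R]_a := jchart (chart_at x) x.

Lemma jmapE i x : dom X i x -> jmap x = jchart i x.
Proof. by move=> xi; apply: jchart_change => //; exact: chart_atP. Qed.

Lemma smooth_jmap i : smooth_on (U i) (jmap \o ci i).
Proof.
move=> k; have oU := @chart_open R _ X i.
apply: (Ck_on_eq oU _ (smooth_jchart i k)) => y Uy.
have [yi ye] := dom_chart_inv Uy.
by rewrite /= (jmapE yi).
Qed.

Lemma jmap_cubic x : jmap x *m jmap x *m jmap x + jmap x = 0.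
Proof.
apply: extendJ_cube; first exact: jac_free (chart_atP x).
exact: acm_J_sqr (chart_atP x).
Qed.

(** Differentiating the identity [jmap_cubic] gives precisely the equation of the tangent space of
    the variety. *)
Lemma diff_jmap_cubic i x v : dom X i x ->
  let j := jmap x in let W := 'd (jmap \o ci i) (ch i x) v in
  j *m j *m W + j *m W *m j + W *m j *m j + W = 0.
Proof.
move=> xi j W; set F := jmap \o ci i.
have dF : differentiable F (ch i x).
  exact: (smooth_on_differentiable (smooth_jmap i) (in_chart xi)).
have Fx : F (ch i x) = j by rewrite /F /= chartK.
have oU := @chart_open R _ X i.
have S2 : smooth_on (U i) (fun y => F y *m F y).
  by move=> k; apply: (Ck_on_mulmx oU (smooth_jmap i k) (smooth_jmap i k)).
have S3 : smooth_on (U i) (fun y => F y *m F y *m F y).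
  by move=> k; apply: (Ck_on_mulmx oU (S2 k) (smooth_jmap i k)).
have d2 := smooth_on_differentiable S2 (in_chart xi).
have d3 := smooth_on_differentiable S3 (in_chart xi).
have c0 : (fun y => F y *m F y *m F y + F y) = cst 0.
  by apply/funext => y; exact: jmap_cubic.
have e0 : 'd (fun y => F y *m F y *m F y + F y) (ch i x) v = 0.
  by rewrite c0; exact: (congr1 (fun h => h v) (diff_cst _ _)).
have e1 : 'd (fun y => F y *m F y *m F y + F y) (ch i x) v =
    'd (fun y => F y *m F y *m F y) (ch i x) v + 'd F (ch i x) v.
  exact: (congr1 (fun h => h v) (diffD d3 dF)).
have e2 : 'd (fun y => F y *m F y) (ch i x) v = W *m j + j *m W.
  by apply: (etrans (diff_mulmx v dF dF)); rewrite Fx.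
have e3 : 'd (fun y => F y *m F y *m F y) (ch i x) v =
    'd (fun y => F y *m F y) (ch i x) v *m j + j *m j *m W.
  by apply: (etrans (diff_mulmx v d2 dF)); rewrite Fx.
have h : (W *m j + j *m W) *m j + j *m j *m W + W = 0.
  exact: (etrans (esym (etrans e1 (congr1 (fun D => D + W)
    (etrans e3 (congr1 (fun D => D *m j + j *m j *m W) e2))))) e0).
rewrite -h mulmxDl.
move: (j *m j *m W) (j *m W *m j) (W *m j *m j) => A B D.
by apply/matrixP => u w; rewrite !mxE; ring.
Qed.

Definition gmap x : 'rV[R]_m := row_mx (row_mx (phi x) (mxvec (jmap x))) 0.

Lemma smooth_gmap : @smooth_map R _ X m gmap.
Proof.
move=> i k; have oU := @chart_open R _ X i.
have C1 := Ck_on_row_mx oU (sphi i k) (Ck_on_mxvec oU (smooth_jmap i k)).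
exact: (Ck_on_row_mx oU C1 (Ck_on_cst k (0 : 'rV[R]_e) oU)).
Qed.

Definition fmap x : 'rV[C]_m := RC (gmap x).

Lemma diff_gmap_x i x v : dom X i x ->
  lsubmx (lsubmx ('d (gmap \o ci i) (ch i x) v)) = v *m jac i (ch i x).
Proof.
move=> xi; rewrite mul_jac; apply/rowP => k; rewrite [LHS]mxE [LHS]mxE.
have dg := smooth_on_differentiable (smooth_gmap i) (in_chart xi).
have dp := smooth_on_differentiable (sphi i) (in_chart xi).
have [_ <-] := diff_mxE v 0 (lshift e (lshift (a * a) k)) dg.
have [_ <-] := diff_mxE v 0 k dp.
rewrite (_ : (fun y => (gmap \o ci i) y 0 _) = (fun y => (phi \o ci i) y 0 k)) //.
by apply/funext => y; rewrite /= /gmap !row_mxEl.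
Qed.

Lemma diff_gmap_j i x v : dom X i x ->
  vec_mx (rsubmx (lsubmx ('d (gmap \o ci i) (ch i x) v))) =
  'd (jmap \o ci i) (ch i x) v.
Proof.
move=> xi; apply/matrixP => k l; rewrite [LHS]mxE [LHS]mxE [LHS]mxE.
have dg := smooth_on_differentiable (smooth_gmap i) (in_chart xi).
have dj := smooth_on_differentiable (smooth_jmap i) (in_chart xi).
have [_ <-] := diff_mxE v 0 (lshift e (rshift a (mxvec_index k l))) dg.
have [_ <-] := diff_mxE v k l dj.
rewrite (_ : (fun y => (gmap \o ci i) y 0 _) = (fun y => (jmap \o ci i) y k l)) //.
by apply/funext => y; rewrite /= /gmap row_mxEl row_mxEr mxvecE.
Qed.

Lemma realify_fmap : @realify R m \o fmap = (fun x => row_mx (gmap x) 0).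
Proof.
apply/funext => x; rewrite /= /realify; congr row_mx.
  by apply/rowP => k; rewrite !mxE.
by apply/rowP => k; rewrite !mxE.
Qed.

Lemma smooth_realify_fmap : @smooth_map R _ X (m + m) (@realify R m \o fmap).
Proof.
move=> i k; rewrite realify_fmap; have oU := @chart_open R _ X i.
exact: (Ck_on_row_mx oU (smooth_gmap i k) (Ck_on_cst k (0 : 'rV[R]_m) oU)).
Qed.

Lemma pushforward_fmap i x v : dom X i x ->
  Defs.pushforward fmap i x v = RC ('d (gmap \o ci i) (ch i x) v).
Proof.
move=> xi; rewrite /Defs.pushforward.
have dg := smooth_on_differentiable (smooth_gmap i) (in_chart xi).
have [_ e1] := diff_mulmxr (row_mx 1%:M (0 : 'M[R]_(m, m))) v dg.
have -> : @realify R m \o fmap \o ci i =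
    (fun y => (gmap \o ci i) y *m row_mx 1%:M 0).
  rewrite realify_fmap; apply/funext => y.
  by rewrite /= mul_mx_row mulmx1 mulmx0.
rewrite e1 mul_mx_row mulmx1 mulmx0; apply/rowP => k.
by rewrite [LHS]mxE row_mxKl row_mxKr !mxE.
Qed.

Local Notation Zv := (@Zvar R n a e).
Local Notation Dv := (@Dvar R a e).

Lemma xpart_RC (w : 'rV[R]_m) : xpart (RC w) = RC (lsubmx (lsubmx w)).
Proof. by apply/rowP => k; rewrite !mxE. Qed.

Lemma jpart_RC (w : 'rV[R]_m) : jpart (RC w) = RC (vec_mx (rsubmx (lsubmx w))).
Proof. by apply/matrixP => k l; rewrite !mxE. Qed.

Lemma jpart_fmap x : jpart (fmap x) = RC (jmap x).
Proof. by rewrite jpart_RC /gmap row_mxKl row_mxKr mxvecK. Qed.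

Lemma Zvar_fmap x : Zv (fmap x).
Proof.
have fr := jac_free (chart_atP x); have JJ := acm_J_sqr (chart_atP x).
have t1 : \tr (jmap x) = 0.
  by rewrite (mxtrace_extendJ _ fr) (mxtrace_complex_structure JJ).
have t2 := mxtrace_extendJ_sqr fr JJ.
apply/ZvarP; rewrite jpart_fmap; split.
- by rewrite /cubic -!map_mxM -map_mxD jmap_cubic map_mx0.
- by rewrite trace_map_mx t1 rmorph0.
- by rewrite -map_mxM trace_map_mx t2 rmorphN rmorph_nat mul2n.
Qed.

Lemma real_part_fmap x : real_part Zv (@conjpt R a e) (fmap x).
Proof.
split; first exact: Zvar_fmap.
by apply/rowP => k; rewrite [LHS]mxE [fmap x 0 k]mxE; exact: conjc_real.
Qed.

Lemma tangent_pushforward i x v : dom X i x ->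
  tangent_space Zv (fmap x) (Defs.pushforward fmap i x v).
Proof.
move=> xi; apply/(tangent_ZvarP _ (Zvar_fmap x)).
rewrite pushforward_fmap // jpart_RC diff_gmap_j // jpart_fmap.
have := diff_jmap_cubic v xi => /= /(congr1 (map_mx (real_complex R))).
by rewrite /cubic_diff !map_mxD !map_mxM map_mx0.
Qed.

Lemma eproj_fmap i x : dom X i x -> eproj 'i (jpart (fmap x)) =
  RC (pseudoinv (jac i (ch i x))) *m holproj (acm_J i x) *m RC (jac i (ch i x)).
Proof.
move=> xi; rewrite jpart_fmap (jmapE xi) eproj_extendJ //; first exact: jac_free.
exact: acm_J_sqr.
Qed.

(** This is the class of a pushed vector modulo the distribution, under the identification of the
    quotient with the image of the projector. Transversality and the computation of the induced
    structure both reduce to this formula. *)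
Lemma push_eproj i x v : dom X i x ->
  xpart (Defs.pushforward fmap i x v) *m eproj 'i (jpart (fmap x)) =
  RC v *m holproj (acm_J i x) *m RC (jac i (ch i x)).
Proof.
move=> xi; rewrite pushforward_fmap // xpart_RC diff_gmap_x // (eproj_fmap xi).
have := mul_pseudoinv (jac_free xi).
move: (pseudoinv _) => B; move: (jac _ _) (holproj _) => A H AB.
have ABC : RC A *m RC B = 1%:M by rewrite -map_mxM AB map_mx1.
by rewrite map_mxM -!mulmxA (mulmxA (RC A)) ABC mul1mx.
Qed.

Lemma transverse_fmap : @transverse R _ m X Zv Dv fmap.
Proof.
move=> i x xi; have Zx := Zvar_fmap x; have JJ := acm_J_sqr xi.
split=> [w|v]; last first.
  move=> /(DvarP _ Zx)[]; rewrite push_eproj // => vP _.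
  suff -> : v = 0 by rewrite pushforward_fmap // linear0 map_mx0.
  apply: (holproj_real_inj (J := acm_J i x)).
  have := mul_pseudoinv (jac_free xi); move: (pseudoinv _) => B.
  move: (jac _ _) vP => A vP AB.
  rewrite -[LHS]mulmx1 -(map_mx1 (real_complex R)) -AB map_mxM mulmxA vP.
  by rewrite mul0mx.
split=> [tw|[v [u [uD ->]]]]; last first.
  apply: tangent_spaceD; first exact: tangent_pushforward.
  by have [] := (DvarP u Zx).1 uD.
(* The class of [w] is [c *m holproj *m RC A] with [c = xpart w *m RC (pseudoinv A)], [A] being the
   Jacobian of [phi]. Some real [v] has the same class, so [w] minus its pushforward lies in the
   distribution. *)
have [v hv] := real_holproj JJ (xpart w *m RC (pseudoinv (jac i (ch i x)))).
exists v, (w - Defs.pushforward fmap i x v); split; last by rewrite addrC subrK.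
apply/(DvarP _ Zx); split.
  rewrite -scaleN1r xpartD xpartZ mulmxDl -scalemxAl push_eproj // -hv.
  by rewrite (eproj_fmap xi) !mulmxA scaleN1r subrr.
apply: tangent_spaceD => //; rewrite -scaleN1r; apply: tangent_spaceZ.
exact: tangent_pushforward.
Qed.

(** By [push_eproj] the claim becomes [J *m holproj = 'i *: holproj], together with the stability of
    tangent spaces under complex combinations. *)
Lemma induces_J_fmap : @induces_J R n m X Dv fmap.
Proof.
move=> i x v xi; have Zx := Zvar_fmap x; have JJ := acm_J_sqr xi.
apply/(DvarP _ Zx); rewrite -scaleNr; split.
  rewrite xpartD xpartZ mulmxDl -scalemxAl !push_eproj // map_mxM.
  have := mul_holproj JJ; move: (holproj _) => H JH.
  rewrite -(mulmxA (RC v) (RC (acm_J i x)) H) JH -scalemxAr -scalemxAl scaleNr.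
  by rewrite subrr.
apply: tangent_spaceD; first exact: tangent_pushforward.
by apply: tangent_spaceZ; exact: tangent_pushforward.
Qed.

Lemma smooth_embedding_fmap : compact [set: X] -> @smooth_embedding R _ m X fmap.
Proof.
move=> cX; have [_ injphi imm] := ephi.
have injg : injective gmap by move=> x y /eq_row_mx[/eq_row_mx[/injphi]].
have injr : injective (@realify R m \o fmap).
  by rewrite realify_fmap => x y /eq_row_mx[/injg].
split.
- exact: smooth_realify_fmap.
- move=> i x xi v w; rewrite !pushforward_fmap // => /map_mx_inj e1.
  apply/eqP; rewrite -subr_eq0; apply/eqP; apply: (imm i x) => //.
  rewrite -mul_jac -(diff_gmap_x _ xi) linearB /= e1 subrr.
  by apply/rowP => k; rewrite !mxE.
- by move=> x y /(congr1 (@realify R m)); exact: injr.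
(* The complement of [V] is compact, so its image is closed; by injectivity the complement of this
   image pulls back to [V]. *)
- move=> V oV; exists (~` ((@realify R m \o fmap) @` ~` V)).
    apply: closed_openC; apply: compact_closed; first exact: norm_hausdorff.
    apply: continuous_compact.
      by apply: continuous_subspaceT; apply: smooth_map_continuous smooth_realify_fmap.
    apply: (subclosed_compact _ cX) => //; exact: open_closedC.
  apply/seteqP; split=> [x Vx [y nVy /injr yx]|x nx]; first by apply: nVy; rewrite yx.
  by apply: contrapT => nVx; apply: nx; exists x.
Qed.

End AlmostComplexEmbedding.

Theorem theorem1p2 (R : realType) (n k : nat) (hn : (1 <= n)%N)
    (hk : (4 * n <= k)%N) :
  let N := (2 * k + 2 * (k ^ 2 + n * (k - n)))%N in
  exists (m : nat) (Z : set 'rV[R[i]]_m)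
         (sigma : 'rV[R[i]]_m -> 'rV[R[i]]_m)
         (D : 'rV[R[i]]_m -> {vspace 'rV[R[i]]_m}),
    [/\ affine_algebraic_manifold N Z,
        real_structure Z sigma,
        algebraic_distribution N n Z D &
        forall X : almost_complex_manifold R n, compact [set: X] ->
          exists f : X -> 'rV[R[i]]_m,
            [/\ smooth_embedding f,
                forall x, real_part Z sigma (f x),
                transverse Z D f &
                induces_J D f]].
Proof.
(* The target dimension of Whitney's theorem for a manifold of real dimension [2 * n]. *)
move=> N; pose a := (2 * (2 * n) + 1)%N.
have ha : (n.*2 <= a)%N by rewrite /a; lia.
(* This subtraction is truncated; [eN] checks that it loses nothing, and this is where [4 * n <= k]
   and [1 <= n] are needed. *)
pose e := (N - (a + (a * a - (n ^ 2 + n ^ 2 + (a - n.*2) ^ 2))))%N.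
have eN : dimZ n a e = N.
  have sq : (a * a - (n ^ 2 + n ^ 2 + (a - n.*2) ^ 2) = 10 * n ^ 2 + 4 * n)%N.
    have -> : (a - n.*2 = 2 * n + 1)%N by rewrite /a; lia.
    rewrite /a (_ : (_ * _ = (n ^ 2 + n ^ 2 + (2 * n + 1) ^ 2) +
      (10 * n ^ 2 + 4 * n))%N); first by rewrite addKn.
    by ring.
  rewrite /dimZ /e sq subnKC // /N /a.
  (* With [k = 4 n + l] and [n = p + 1], the excess of [N] over the dimension of the pairs [(x, j)]
     is a polynomial in [p] and [l] with nonnegative coefficients. *)
  have [l ->] : exists l, k = (4 * n + l)%N by exists (k - 4 * n)%N; rewrite subnKC.
  have [p ->] : exists p, n = (p + 1)%N by exists n.-1; rewrite addn1 prednK.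
  have -> : (4 * (p + 1) + l - (p + 1) = 3 * (p + 1) + l)%N by lia.
  rewrite (_ : (2 * (4 * (p + 1) + l) + _ = 2 * (2 * (p + 1)) + 1 +
    (10 * (p + 1) ^ 2 + 4 * (p + 1)) +
    (28 * p ^ 2 + 56 * p + 27 + 2 * l + 18 * (p + 1) * l + 2 * l ^ 2))%N).
    exact: leq_addr.
  by ring.
exists (a + a * a + e)%N, (@Zvar R n a e), (@conjpt R a e), (@Dvar R a e).
rewrite -eN; split.
- exact: affine_Zvar.
- exact: real_structure_Zvar.
- exact: distribution_Dvar.
- move=> X cX; have [phi ephi] := whitney_embedding cX (leqnn a).
  exists (fmap e phi); split.
  + exact: (smooth_embedding_fmap e ephi cX).
  + exact: (real_part_fmap e ephi).
  + exact: (transverse_fmap e ephi).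
  + exact: (induces_J_fmap e ephi).
Qed.
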